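(* Let $p\in(1,\infty)$ and let $Q$ be any given cube of $\mathbb{R}^n$. Then both of the following inclusions are proper: $$RM_{p,1,0}(Q)\subsetneqq\widetilde{JN}_{(p,1,0)_0}(Q)\subsetneqq JN_{(p,1,0)_0}(Q).$$
   Context: A cube in $\mathbb{R}^n$ has finite positive edge length and edges parallel to the coordinate axes; it need not be open or closed. Functions are real-valued. For a cube $R$, $f_R:=\fint_R f:=\frac1{|R|}\int_R f$ and $|f|_R:=\fint_R|f|$. For $f\in L^1(Q)$, with all suprema over all collections $\{Q_i\}_i$ of cubes contained in $Q$ with pairwise disjoint interiors, set $$\|f\|_{RM_{p,1,0}(Q)}:=\sup\Big\{\sum_i|Q_i|\Big[\fint_{Q_i}|f|\Big]^p\Big\}^{1/p},$$ $$\|f\|_{\widetilde{JN}_{(p,1,0)_0}(Q)}:=\sup\Big\{\sum_i|Q_i|\Big[\fint_{Q_i}\big|f-|f|_{Q_i}\big|\Big]^p\Big\}^{1/p},$$ $$\|f\|_{JN_{(p,1,0)_0}(Q)}:=\sup\Big\{\sum_i|Q_i|\Big[\fint_{Q_i}|f-f_{Q_i}|\Big]^p\Big\}^{1/p}.$$ Each space is the set of $f\in L^1(Q)$ for which the corresponding quantity is finite. *)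

(* Defs.v *)
From HB Require Import structures.
From mathcomp Require Import all_boot all_order all_algebra.
From mathcomp Require Import all_classical all_reals all_analysis.

Set Implicit Arguments.
Unset Strict Implicit.
Unset Printing Implicit Defensive.

Import Order.TTheory GRing.Theory Num.Theory.
Import numFieldNormedType.Exports.

Local Open Scope classical_set_scope.
Local Open Scope ring_scope.

(* Euclidean space is 'rV[R]_n.+1 throughout, i.e. the dimension n.+1 ranges  *)
(* over the positive integers. The Lebesgue outer measure of a set is the     *)
(* infimum of the total volume of its countable covers by boxes               *)
(* \prod_i ]a_i, b_i].                                                        *)
Section lebesgue_outer.
Context {R : realType} {n : nat}.
Implicit Types (a b : 'rV[R]_n.+1) (A : set 'rV[R]_n.+1).

Definition box a b : set 'rV[R]_n.+1 :=
  [set x | forall i, x ord0 i \in `]a ord0 i, b ord0 i]].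

Definition box_volume a b : R := \prod_i (b ord0 i - a ord0 i).

Definition box_cover A : set (nat -> 'rV[R]_n.+1 * 'rV[R]_n.+1) :=
  [set B : nat -> 'rV[R]_n.+1 * 'rV[R]_n.+1 | (forall k i, (B k).1 ord0 i <= (B k).2 ord0 i) /\
    A `<=` \bigcup_k box (B k).1 (B k).2].

Local Open Scope ereal_scope.

Definition lebesgue_outer A : \bar R :=
  ereal_inf [set \sum_(k <oo) (box_volume (B k).1 (B k).2)%:E |
    B in box_cover A].

Let box_volume_ge0 A B k : box_cover A B ->
  0 <= (box_volume (B k).1 (B k).2)%:E.
Proof. by move=> [B12 _]; rewrite lee_fin prodr_ge0// => i _; rewrite subr_ge0. Qed.

Let lebesgue_outer_ge0 A : 0 <= lebesgue_outer A.
Proof.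
apply: le_ereal_inf_tmp => x [B cB <-{x}].
by apply: nneseries_ge0 => k _ _; exact: box_volume_ge0 cB.
Qed.

Let lebesgue_outer0 : lebesgue_outer set0 = 0.
Proof.
apply/eqP; rewrite eq_le lebesgue_outer_ge0 andbT.
apply: ereal_inf_lbound; exists (fun=> (0%R, 0%R)); first by split.
rewrite eseries0// => k _ _.
by rewrite /box_volume big_ord_recl /= subrr mul0r.
Qed.

Let le_lebesgue_outer : {homo lebesgue_outer : A B / A `<=` B >-> A <= B}.
Proof.
move=> A B AB; apply/ereal_inf_le_tmp => x [C [C12 BC]] <-{x}.
by exists C => //; split => //; exact: subset_trans BC.
Qed.

Let lebesgue_outer_sigma_subadditive : sigma_subadditive lebesgue_outer.
Proof.
move=> A; have [[i ioo]|] := pselect (exists i, lebesgue_outer (A i) = +oo).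
  rewrite (eseries_pinfty _ _ ioo) ?leey// => k _.
  by rewrite -ltNye (lt_le_trans _ (lebesgue_outer_ge0 _)).
rewrite -forallNE => Aoo.
apply/lee_addgt0Pr => _/posnumP[e].
rewrite (le_trans _ (epsilon_trick _ _ _))//.
pose vol (B : 'rV[R]_n.+1 * 'rV[R]_n.+1) := (box_volume B.1 B.2)%:E.
pose P k B := box_cover (A k) B /\
  \sum_(j <oo) vol (B j) <= lebesgue_outer (A k) + (e%:num / (2 ^ k.+1)%:R)%:E.
have [G PG] : {G & forall k, P k (G k)}.
  apply: (@choice _ _ P) => k; rewrite /P.
  have fA : lebesgue_outer (A k) \is a fin_num.
    by rewrite ge0_fin_numE// ltey; apply/eqP; exact: Aoo.
  have e1 : (0 < e%:num / (2 ^ k.+1)%:R)%R by [].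
  have [x [B cB <-] Bx] := lb_ereal_inf_adherent e1 fA.
  by exists B; split => //; exact: ltW.
have vol_ge0 (ij : nat * nat) : 0 <= vol (G ij.1 ij.2).
  exact: box_volume_ge0 (PG ij.1).1.
apply: (@le_trans _ _ (\esum_(ij in [set: nat * nat]) vol (G ij.1 ij.2))).
  have /card_esym/ppcard_eqP[f] := card_nat2.
  apply: ereal_inf_lbound; exists (fun k => G (f k).1 (f k).2).
    split => [k i|x [k _ /(PG k).1.2[j _ xj]]]; first exact: (PG _).1.1.
    by exists (f^-1%FUN (k, j)) => //; rewrite invK ?inE.
  rewrite -[in RHS](image_eq f).
  by rewrite -(esum_pred_image (fun ij => vol (G ij.1 ij.2)) _ xpredT)
    ?[fun=> _]set_true.
rewrite (_ : [set: nat * nat] = setT `*`` (fun=> setT)); last first.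
  by apply/seteqP; split.
rewrite -(@esum_esum _ _ _ setT (fun=> setT) (fun i j => vol (G i j)))//; last first.
  by move=> i j _ _; exact: vol_ge0 (i, j).
rewrite nneseries_esumT; last by move=> k; rewrite adde_ge0.
apply: le_esum => k _; rewrite -nneseries_esumT; first exact: (PG k).2.
by move=> j; exact: vol_ge0 (k, j).
Qed.

HB.instance Definition _ := isOuterMeasure.Build R 'rV[R]_n.+1 lebesgue_outer
  lebesgue_outer0 lebesgue_outer_ge0 le_lebesgue_outer
  lebesgue_outer_sigma_subadditive.

End lebesgue_outer.

Section cubes.
Context {R : realType} {n : nat}.
Implicit Types (Q S : set 'rV[R]_n.+1) (f : 'rV[R]_n.+1 -> R) (p : R).

(* The Lebesgue measure, on the sigma-algebra of all the                      *)
(* Lebesgue-measurable sets.                                                  *)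
Definition lebesgue_meas :
    set (caratheodory_type (@lebesgue_outer R n)) -> \bar R :=
  lebesgue_outer.

Let outer : {outer_measure set 'rV[R]_n.+1 -> \bar R} := lebesgue_outer.

HB.instance Definition _ := isMeasure.Build _
  (caratheodory_type (@lebesgue_outer R n)) R lebesgue_meas
  (@caratheodory_measure0 _ _ outer) (@caratheodory_measure_ge0 _ _ outer)
  (@caratheodory_measure_sigma_additive _ _ outer).

(* Axis-parallel, of edge length l > 0; lo i (resp. hi i) tells whether the   *)
(* i-th edge contains its left endpoint (resp. misses its right endpoint).    *)
Definition is_cube Q : Prop :=
  exists (a : 'rV[R]_n.+1) (l : R) (lo hi : 'I_n.+1 -> bool), 0 < l /\
    Q = [set x | forall i, x ord0 i \in
      Interval (BSide (lo i) (a ord0 i)) (BSide (hi i) (a ord0 i + l))].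

(* A collection is a set of cubes: in an indexed family with pairwise         *)
(* disjoint interiors the cubes are distinct. It is automatically countable,  *)
(* and may be finite.                                                         *)
Definition cube_collection Q (C : set (set 'rV[R]_n.+1)) : Prop :=
  [/\ forall S, C S -> is_cube S,
      forall S, C S -> S `<=` Q &
      trivIset C (fun S => S°)].

Definition volume S : R := fine (lebesgue_meas S).

Definition avg S f : R := (volume S)^-1 * (\int[lebesgue_meas]_(x in S) f x)%R.

(* Functions are total on R^n; only their values on Q matter.                 *)
Definition L1 Q : set ('rV[R]_n.+1 -> R) :=
  [set f | lebesgue_meas.-integrable Q (EFin \o f)].

(* \sup (\sum_S |S| F(S) ^ p) ^ (1/p) over all cube collections in Q, for     *)
(* F >= 0.                                                                    *)
Definition cube_norm p Q (F : set 'rV[R]_n.+1 -> R) : \bar R :=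
  (ereal_sup [set (\esum_(S in C) (volume S * F S `^ p)%:E)%E |
     C in cube_collection Q] `^ p^-1)%E.

Definition RM_norm p Q f : \bar R :=
  cube_norm p Q (fun S => avg S (fun x => `|f x|)).

Definition JNt_norm p Q f : \bar R :=
  cube_norm p Q (fun S => avg S (fun x => `|f x - avg S (fun y => `|f y|)|)).

Definition JN_norm p Q f : \bar R :=
  cube_norm p Q (fun S => avg S (fun x => `|f x - avg S f|)).

Definition RM p Q : set ('rV[R]_n.+1 -> R) :=
  [set f | L1 Q f /\ (RM_norm p Q f < +oo)%E].

Definition JNt p Q : set ('rV[R]_n.+1 -> R) :=
  [set f | L1 Q f /\ (JNt_norm p Q f < +oo)%E].

Definition JN p Q : set ('rV[R]_n.+1 -> R) :=
  [set f | L1 Q f /\ (JN_norm p Q f < +oo)%E].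

End cubes.

(* Main.v *)
Require Import Defs.
From mathcomp Require Import all_boot all_order all_algebra.
From mathcomp Require Import all_classical all_reals all_analysis.
From mathcomp Require Import finmap measurable_realfun lra.

(* RM_p is contained in JNt_p, and JNt_p in JN_p, by the triangle inequality. *)
(* Both inclusions are strict as soon as some f >= 0 lies in JN_p but not in  *)
(* RM_p: then JNt_p and JN_p have the same functional on f, while the JNt_p   *)
(* functional of -f dominates the RM_p functional of f.                       *)
(*                                                                            *)
(* Such an f is f(x) = phi(x_0) with phi = \sum_k u_k, u_k = v_k ^ (1/p),     *)
(* where v_k(t) = \prod_(j <= k) (1 + cos(N_j t) / 2) is a Riesz product with *)
(* a rapidly increasing sequence N_j. There are scales d_k -> 0 such that, on *)
(* intervals of length at least d_(k+1), v_(k+1) has almost the same mean as  *)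
(* v_k and the mean of u_(k+1) is at most a < 1 times that of u_k, whereas    *)
(* u_k is almost constant on shorter intervals. Hence the oscillation of f on *)
(* a cube S of edge between d_(j+1) and d_j is at most C (1 + (u_j)_S), and   *)
(* (u_j)_S ^ p <= (v_j)_S <= (v_J)_S + 1 for all J >= j: over disjoint cubes  *)
(* the sum is controlled by the integral of one single v_J, which is bounded. *)
(* On the other hand (\sum_k u_k) ^ p >= \sum_k v_k has infinite integral, so *)
(* the averages of f over fine grids make the RM_p functional infinite.       *)

(** With q = 1/p, the engine is the gap between a concave power and its tangent: a factor 1 + cos/2
    has mean 1 over a period, but by [powR_concave_lt] its q-th power has mean at most a = 1 -
    q(1-q)/64. A large frequency makes a new factor nearly independent of the previous ones on all
    intervals longer than a scale fixed beforehand. So the means of v_k are almost preserved while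
    those of u_k decay geometrically ([riesz_step], iterated in [riesz_products]). Hence the series
    of the u_k converges almost everywhere, although every v_k keeps mean at least 1/2 on long
    intervals.

    [one_dimensional_example] collects what is used of phi: its oscillation is bounded by the mean
    of [v J] for every large J, and its means on short intervals are bounded below. [integral_cube]
    carries means on the line to averages over cubes. [coordinate_JNt] sums the upper bound over
    disjoint cubes, [coordinate_not_RM] the lower bound over grids. For f >= 0, [JN_oppr] and
    [JNt_oppr_RM] exploit that the JN functional is invariant under f -> -f while the JNt functional
    is not. *)

Set Implicit Arguments.
Unset Strict Implicit.
Unset Printing Implicit Defensive.

Import Order.TTheory GRing.Theory Num.Theory.
Import numFieldNormedType.Exports.

Local Open Scope classical_set_scope.
Local Open Scope ring_scope.

(** * Lebesgue measure of boxes *)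

Section box_measure.
Context {R : realType} {n : nat}.
Implicit Types (a b : 'rV[R]_n.+1) (x : 'I_n.+1 -> R).

(* The indicator function of the box ]a, b] with its first m coordinates      *)
(* integrated out.                                                            *)
Definition partial_volume (m : nat) a b x : R :=
  \prod_(i < n.+1) (if (i < m)%N then b ord0 i - a ord0 i
           else \1_(`]a ord0 i, b ord0 i]) (x i)).

Lemma partial_volume_ge0 m a b x : (forall i, a ord0 i <= b ord0 i) ->
  0 <= partial_volume m a b x.
Proof.
by move=> ab; apply: prodr_ge0 => i _; case: ifP => _; rewrite ?subr_ge0.
Qed.

(** As a function of coordinate [m] alone, [partial_volume m] is a multiple of an interval
    indicator; replacing this indicator by its integral gives [partial_volume m.+1]. *)
Lemma partial_volume_upd (m : nat) (lt_mn : (m < n.+1)%N) a b x :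
  let i0 := Ordinal lt_mn in
  exists c : R, (forall t, partial_volume m a b (fun i => if i == i0 then t else x i)
      = c * \1_(`]a ord0 i0, b ord0 i0]) t) /\
    partial_volume m.+1 a b x = c * (b ord0 i0 - a ord0 i0) /\
    ((forall i, a ord0 i <= b ord0 i) -> 0 <= c).
Proof.
move=> i0; exists (\prod_(i < n.+1 | i != i0) (if (i < m)%N then b ord0 i - a ord0 i
           else \1_(`]a ord0 i, b ord0 i]) (x i))); split; [|split].
- move=> t; rewrite /partial_volume (bigD1 i0)//= ltnn eqxx mulrC; congr (_ * _).
  by apply: eq_bigr => i /negbTE ->.
- rewrite /partial_volume (bigD1 i0)//= ltnS leqnn mulrC; congr (_ * _).
  apply: eq_bigr => i ii0; rewrite ltnS leq_eqVlt.
  by have /negbTE -> : (i : nat) != m by apply: contra ii0 => /eqP im; apply/eqP/val_inj.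
- by move=> ab; apply: prodr_ge0 => i _; case: ifP => _; rewrite ?subr_ge0.
Qed.

Lemma partial_volume_full a b x : partial_volume n.+1 a b x = box_volume a b.
Proof. by apply: eq_bigr => i _; rewrite ltn_ord. Qed.

Local Open Scope ereal_scope.

Lemma measurable_partial_volume_upd m (lt_mn : (m < n.+1)%N) a b x :
  measurable_fun setT (fun t : R => (partial_volume m a b
     (fun i => if i == Ordinal lt_mn then t else x i))%:E : \bar R).
Proof.
have [c [cE _]] := partial_volume_upd lt_mn a b x.
apply/measurable_EFinP; under eq_fun do rewrite cE.
by apply: measurable_funM => //; exact: measurable_indic.
Qed.

Lemma integral_partial_volume m (lt_mn : (m < n.+1)%N) a b x :
  (forall i, a ord0 i <= b ord0 i)%R ->
  \int[lebesgue_measure]_t (partial_volume m a b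
     (fun i => if i == Ordinal lt_mn then t else x i))%:E =
  (partial_volume m.+1 a b x)%:E.
Proof.
move=> ab; have [c [cE [-> c0]]] := partial_volume_upd lt_mn a b x.
under eq_integral do rewrite cE EFinM.
rewrite ge0_integralZl//; last 2 first.
- by apply/measurable_EFinP; exact: measurable_indic.
- by rewrite lee_fin c0.
rewrite integral_indic//= setIT lebesgue_measure_itv/= lte_fin EFinM -EFinD.
case: ltP => // ba; suff -> : b ord0 (Ordinal lt_mn) = a ord0 (Ordinal lt_mn).
  by rewrite subrr.
by apply/eqP; rewrite eq_le ba ab.
Qed.

(** Iterated integration by hand: for m = 0 the claim [H] is the pointwise inequality between the
    indicators of the box and of its cover, and each induction step integrates one more coordinate
    over the line, exchanging sum and integral by monotone convergence. In the end only volumes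
    remain. *)
Lemma box_cover_le a b B : (forall i, a ord0 i <= b ord0 i)%R ->
  box_cover (box a b) B ->
  (box_volume a b)%:E <= \sum_(k <oo) (box_volume (B k).1 (B k).2)%:E.
Proof.
move=> ab [B12 aB].
have G0 m k x : 0 <= (partial_volume m (B k).1 (B k).2 x)%:E.
  by rewrite lee_fin partial_volume_ge0.
suff H m x : (m <= n.+1)%N ->
    (partial_volume m a b x)%:E <= \sum_(k <oo) (partial_volume m (B k).1 (B k).2 x)%:E.
  have := H n.+1 (fun=> 0%R) (leqnn _).
  rewrite partial_volume_full; under eq_eseriesr do rewrite partial_volume_full.
  by [].
elim: m x => [x _|m IH x mn].
  have [xab|xab] := pselect (forall i, x i \in `]a ord0 i, b ord0 i]); last first.
    move/existsNP : xab => [i xi].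
    suff -> : partial_volume 0 a b x = 0%R by exact: nneseries_ge0.
    by rewrite /partial_volume (bigD1 i)//= indicE memNset ?mul0r.
  have /aB [k _ xk] : box a b (\row_i x i) by move=> i; rewrite mxE.
  apply: (@le_trans _ _ (partial_volume 0 (B k).1 (B k).2 x)%:E).
    rewrite lee_fin /partial_volume /= !big1 ?lexx// => i _.
      by rewrite indicE mem_set//; have := xk i; rewrite mxE.
    by rewrite indicE mem_set//; exact: xab.
  by rewrite (@nneseriesD1 _ _ k)//= leeDl// nneseries_ge0.
rewrite -(integral_partial_volume mn)//.
under eq_eseriesr do rewrite -(integral_partial_volume mn)//.
rewrite -integral_nneseries//; last first.
  by move=> k; exact: measurable_partial_volume_upd.
apply: ge0_le_integral => //.
- by move=> t _; rewrite lee_fin partial_volume_ge0.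
- exact: measurable_partial_volume_upd.
- by apply: ge0_emeasurable_sum => // k _; exact: measurable_partial_volume_upd.
- by move=> t _; apply: IH; exact: ltnW.
Qed.

Lemma box_volume_ge0 a b : (forall i, a ord0 i <= b ord0 i)%R ->
  (0 <= box_volume a b)%R.
Proof. by move=> ab; apply: prodr_ge0 => i _; rewrite subr_ge0. Qed.

Lemma lebesgue_outer_box a b : (forall i, a ord0 i <= b ord0 i)%R ->
  lebesgue_outer (box a b) = (box_volume a b)%:E.
Proof.
move=> ab; apply/eqP; rewrite eq_le; apply/andP; split; last first.
  by apply: le_ereal_inf_tmp => _ [B cB <-]; exact: box_cover_le.
apply: ereal_inf_lbound.
(* The one-box cover is completed to a sequence by degenerate boxes, of volume zero. *)
exists (fun k => if k == 0%N then (a, b) else (0%R, 0%R)).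
  by split=> [[|k] i//=|x xab]; exists 0%N.
rewrite (@nneseriesD1 _ _ 0)//=; last first.
  move=> [|k] _ /=; rewrite lee_fin; first exact: box_volume_ge0.
  by apply: box_volume_ge0 => i.
rewrite eseries0 ?adde0// => -[|k] _ //= _.
by rewrite /box_volume big_ord_recl /= subrr mul0r.
Qed.

End box_measure.

Lemma ge0_integral_mrestr d (T : measurableType d) (R : realType)
    (mu : {measure set T -> \bar R}) (D A : set T) (mD : measurable D)
    (f : T -> \bar R) : measurable A -> measurable_fun A f ->
  (forall x, A x -> 0 <= f x)%E ->
  (\int[mrestr mu mD]_(x in A) f x = \int[mu]_(x in A `&` D) f x)%E.
Proof.
move=> mA mf f0.
have mDC := measurableC mD.
have mADC := measurableI _ _ mA mDC.
rewrite (@ge0_negligible_integral _ _ _ (mrestr mu mD) A (A `&` ~` D))//; last first.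
  by rewrite /= /mrestr -setIA setICl setI0 measure0.
rewrite setDIr setDv set0U setDE setCK.
by apply: eq_measure_integral => B mB BAD; rewrite /= /mrestr setIidl// => x /BAD[].
Qed.

(** * Measurability of boxes *)

Section boxes_measurable.
Context {R : realType} {n : nat}.
Implicit Types (a b x : 'rV[R]_n.+1).
Let X := caratheodory_type (@lebesgue_outer R n).
Let mu : {measure set X -> \bar R} := @lebesgue_meas R n.

(** Caratheodory's criterion holds because the hyperplane cuts each box of a cover into two boxes
    whose volumes add up exactly. *)
Lemma measurable_le_coord (i : 'I_n.+1) (c : R) :
  measurable ([set x : 'rV[R]_n.+1 | x ord0 i <= c] : set X).
Proof.
apply: le_caratheodory_measurable => A.
apply: le_ereal_inf_tmp => _ [B [B12 AB] <-] /=.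
(* [c] is clamped to the i-th edge, so that both pieces are legitimate boxes even when the
   hyperplane misses the box. *)
pose cut k := Num.max ((B k).1 ord0 i) (Num.min ((B k).2 ord0 i) c).
have cut1 k : (B k).1 ord0 i <= cut k by rewrite /cut le_max lexx.
have cut2 k : cut k <= (B k).2 ord0 i by rewrite /cut ge_max B12 ge_min lexx.
pose B1 k : 'rV[R]_n.+1 * 'rV[R]_n.+1 :=
  ((B k).1, \row_j if j == i then cut k else (B k).2 ord0 j).
pose B2 k : 'rV[R]_n.+1 * 'rV[R]_n.+1 :=
  (\row_j (if j == i then cut k else (B k).1 ord0 j), (B k).2).
have B1le k j : (B1 k).1 ord0 j <= (B1 k).2 ord0 j.
  by rewrite /= mxE; case: eqP => [->|_]; [exact: cut1|exact: B12].
have B2le k j : (B2 k).1 ord0 j <= (B2 k).2 ord0 j.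
  by rewrite /= mxE; case: eqP => [->|_]; [exact: cut2|exact: B12].
have B12E k : box_volume (B k).1 (B k).2 =
    box_volume (B1 k).1 (B1 k).2 + box_volume (B2 k).1 (B2 k).2.
  rewrite /box_volume (bigD1 i)//= [in RHS](bigD1 i)//=.
  rewrite [X in _ = _ + X](bigD1 i)//= !mxE eqxx.
  under [X in _ = _ * X + _]eq_bigr => j /negbTE ji do rewrite mxE ji.
  under [X in _ = _ + _ * X]eq_bigr => j /negbTE ji do rewrite mxE ji.
  by rewrite -mulrDl; congr (_ * _); lra.
under eq_eseriesr do rewrite B12E EFinD.
rewrite nneseriesD; last 2 first.
- by move=> k _; rewrite lee_fin box_volume_ge0.
- by move=> k _; rewrite lee_fin box_volume_ge0.
apply: leeD; apply: ereal_inf_lbound.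
- exists B1 => //; split => // x [/AB[k _ xk] xc]; exists k => // j.
  have := xk j; rewrite !in_itv/= => /andP[-> xb]/=; rewrite mxE.
  by case: eqP => // ji; rewrite /cut le_max le_min -ji xb ji xc orbT.
- exists B2 => //; split => // x [/AB[k _ xk] /negP]; rewrite -ltNge => cx.
  exists k => // j; have := xk j; rewrite !in_itv/= => /andP[ax ->].
  by rewrite mxE andbT; case: eqP => // ji; rewrite /cut gt_max gt_min -ji ax ji cx orbT.
Qed.

Definition coordinate (i : 'I_n.+1) (x : X) : measurableTypeR R := (x : 'rV[R]_n.+1) ord0 i.

Lemma measurable_coordinate i : measurable_fun setT (coordinate i).
Proof.
move=> mT; apply: (measurability _ (RGenOInfty.measurableE R)) => //.
move=> _ [_ [c ->] <-]; rewrite setTI.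
rewrite (_ : _ @^-1` _ = ~` [set x : 'rV[R]_n.+1 | x ord0 i <= c]).
  exact/measurableC/measurable_le_coord.
apply/seteqP; split => x /=; rewrite in_itv/= andbT /coordinate ltNge; first by move/negP.
by move=> h; apply/negP.
Qed.

Definition rect a b (lo hi : 'I_n.+1 -> bool) : set 'rV[R]_n.+1 :=
  [set x | forall i, x ord0 i \in
     Interval (BSide (lo i) (a ord0 i)) (BSide (hi i) (b ord0 i))].

(** Constraining only the coordinates in [P] covers both full boxes and the cylinder over all
    coordinates but the first. *)
Lemma measurable_sides (I : 'I_n.+1 -> interval R) (P : set 'I_n.+1) :
  measurable ([set x : 'rV[R]_n.+1 | forall i, P i -> x ord0 i \in I i] : set X).
Proof.
rewrite (_ : [set _ | _] = \bigcap_(i in P) (coordinate i @^-1` [set` I i])).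
  apply: fin_bigcap_measurable => [|i _]; first exact: finite_finset.
  by rewrite -[X in measurable X]setTI; apply: measurable_coordinate => //; exact: measurable_itv.
by apply/seteqP; split => x /= h i; exact: h.
Qed.

Lemma measurable_rect a b lo hi : measurable (rect a b lo hi : set X).
Proof.
rewrite (_ : rect _ _ _ _ = [set x | forall i, setT i -> x ord0 i \in
  Interval (BSide (lo i) (a ord0 i)) (BSide (hi i) (b ord0 i))]); first exact: measurable_sides.
by apply/seteqP; split => x /= h i; [move=> _|]; exact: h.
Qed.

Lemma bernoulli_le (e : R) (m : nat) : 0 <= e <= 1 -> 1 - m%:R * e <= (1 - e) ^+ m.
Proof.
move=> /andP[e0 e1]; elim: m => [|m IH]; first by rewrite mul0r subr0 expr0.
rewrite exprS; apply: (le_trans _ (ler_wpM2l _ IH)); last by rewrite subr_ge0.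
rewrite -natr1; suff : 0 <= m%:R * e * e by lra.
by rewrite !mulr_ge0.
Qed.

(** The limit e -> 0, taken by hand through Bernoulli's inequality. *)
Lemma le_of_scaled_le (x y : R) (m : nat) : 0 <= y ->
  (forall e, 0 < e < 1 -> (1 - e) ^+ m * x <= y) -> x <= y.
Proof.
move=> y0 H; rewrite leNgt; apply/negP => yx.
have x0 : 0 < x by exact: le_lt_trans yx.
have m0 : 0 < 2 * m.+1%:R * x by rewrite !mulr_gt0.
(* With this [e], m e x <= (x - y)/2, so (1 - m e) x is at least the midpoint of x and y, which
   exceeds y. *)
pose e := (x - y) / (2 * m.+1%:R * x).
have e0 : 0 < e by rewrite divr_gt0// subr_gt0.
have m1 : 1 <= m.+1%:R :> R by rewrite ler1n.
have e1 : e < 1.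
  rewrite ltr_pdivrMr// mul1r.
  have : x <= m.+1%:R * x by rewrite ler_peMl// ltW.
  lra.
have ee : 0 < e < 1 by rewrite e0 e1.
have := H _ ee.
have := @bernoulli_le e m; rewrite (ltW e0) (ltW e1) => /(_ isT) h1 h2.
have : (1 - m%:R * e) * x <= y by apply: le_trans h2; rewrite ler_pM2r.
have : m%:R * e * x <= (x - y) / 2.
  rewrite (_ : (x - y) / 2 = m.+1%:R * e * x); last first.
    have : e * (2 * m.+1%:R * x) = x - y by rewrite /e divfK// gt_eqF.
    lra.
  by rewrite ler_pM2r// ler_pM2r// ler_nat.
lra.
Qed.

End boxes_measurable.

(** * Boxes with arbitrary faces, and integrals of functions of one coordinate *)

Section rect_integral.
Context {R : realType} {n : nat}.
Implicit Types (a b x : 'rV[R]_n.+1).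
Let X := caratheodory_type (@lebesgue_outer R n).
Let mu : {measure set X -> \bar R} := @lebesgue_meas R n.

(** Whatever faces it contains, the box lies between two half-open boxes with edges scaled by 1 - e
    (same left corner) and by 1/(1 - e) (same right corner); then e tends to 0. *)
Lemma lebesgue_meas_rect a b lo hi : (forall i, a ord0 i < b ord0 i) ->
  @lebesgue_meas R n (rect a b lo hi) = (box_volume a b)%:E.
Proof.
move=> ab.
have V0 : 0 <= box_volume a b by apply: box_volume_ge0 => i; exact: ltW.
have inner e : 0 < e < 1 ->
    (((1 - e) ^+ n.+1 * box_volume a b)%:E <= @lebesgue_meas R n (rect a b lo hi))%E.
  move=> /andP[e0 e1].
  pose b' : 'rV[R]_n.+1 := \row_i (a ord0 i + (1 - e) * (b ord0 i - a ord0 i)).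
  have ab' i : a ord0 i <= b' ord0 i.
    by rewrite mxE lerDl mulr_ge0// subr_ge0 ltW.
  rewrite (_ : _ * _ = box_volume a b'); last first.
    rewrite /box_volume -[X in _ ^+ X]card_ord -prodr_const -big_split/=.
    by apply: eq_bigr => i _; rewrite mxE addrAC subrr add0r.
  rewrite -lebesgue_outer_box//; apply: le_outer_measure => x xab i.
  have := xab i; rewrite !in_itv/= mxE => /andP[ax xb].
  have xb' : x ord0 i < b ord0 i.
    apply: (le_lt_trans xb); have : 0 < e * (b ord0 i - a ord0 i) by rewrite mulr_gt0// subr_gt0.
    lra.
  by apply/andP; split; [case: (lo i)|case: (hi i)] => //=; rewrite ltW.
have outer e : 0 < e < 1 ->
    (@lebesgue_meas R n (rect a b lo hi) <= (((1 - e) ^+ n.+1)^-1 * box_volume a b)%:E)%E.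
  move=> /andP[e0 e1].
  pose a' : 'rV[R]_n.+1 := \row_i (b ord0 i - (1 - e)^-1 * (b ord0 i - a ord0 i)).
  have d0 : 0 < 1 - e by rewrite subr_gt0.
  have ab' i : a' ord0 i <= b ord0 i.
    by rewrite mxE gerBl mulr_ge0 ?invr_ge0 ?ltW// subr_gt0.
  have aa' i : a' ord0 i < a ord0 i.
    have : 1 * (b ord0 i - a ord0 i) < (1 - e)^-1 * (b ord0 i - a ord0 i).
      by rewrite ltr_pM2r ?subr_gt0// invf_gt1// gtrBl.
    by rewrite mxE; lra.
  rewrite (_ : _ * _ = box_volume a' b); last first.
    rewrite /box_volume -exprVn -[X in _ ^+ X]card_ord -prodr_const -big_split/=.
    by apply: eq_bigr => i _; rewrite mxE; lra.
  rewrite -lebesgue_outer_box//; apply: le_outer_measure => x xab i.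
  have := xab i; rewrite !in_itv/= => /andP[ax xb]; apply/andP; split.
    by apply: (lt_le_trans (aa' i)); exact: lteifW ax.
  exact: lteifW xb.
have h12 : 0 < (2^-1 : R) < 1 by rewrite invr_gt0 ltr0n/= invf_lt1// ltr1n.
have fin : @lebesgue_meas R n (rect a b lo hi) \is a fin_num.
  rewrite ge0_fin_numE; last exact: (measure_ge0 mu).
  exact: le_lt_trans (outer _ h12) (ltry _).
rewrite -(fineK fin); congr EFin; apply/eqP; rewrite eq_le; apply/andP; split.
  apply: (@le_of_scaled_le _ _ _ n.+1) => // e e01.
  have := outer _ e01; rewrite -(fineK fin) lee_fin => H.
  have d0 : 0 < (1 - e) ^+ n.+1 by move/andP: e01 => [_ e1]; rewrite exprn_gt0// subr_gt0.
  by rewrite mulrC -ler_pdivlMr// mulrC.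
apply: (@le_of_scaled_le _ _ _ n.+1); first by rewrite fine_ge0// (measure_ge0 mu).
by move=> e e01; rewrite -lee_fin (fineK fin) inner.
Qed.

(** Plays the role of Fubini for functions of the first coordinate, by uniqueness of Lebesgue
    measure on the line; it carries the example from the line to cubes. *)
Lemma ge0_integral_rect a b lo hi (h : R -> \bar R) :
  (forall i, a ord0 i < b ord0 i) ->
  measurable_fun setT h -> (forall t, 0 <= h t)%E ->
  (\int[@lebesgue_meas R n]_(x in rect a b lo hi) h (x ord0 ord0) =
   (\prod_(i < n.+1 | i != ord0) (b ord0 i - a ord0 i))%:E *
   \int[lebesgue_measure]_(t in `[a ord0 ord0, b ord0 ord0]) h t)%E.
Proof.
move=> ab mh h0.
set K := \prod_(i < n.+1 | i != ord0) _.
have K0 : 0 < K by apply: prodr_gt0 => i _; rewrite subr_gt0.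
pose side i := Interval (BSide (lo i) (a ord0 i)) (BSide (hi i) (b ord0 i)).
pose T : set X := [set x : 'rV[R]_n.+1 | forall i, i != ord0 -> x ord0 i \in side i].
have mT : measurable T by exact: measurable_sides.
have Ki0 : 0 <= K^-1 by rewrite invr_ge0 ltW.
(* The image under x_0 of the measure restricted to the cylinder T is K times *)
(* the Lebesgue measure of the line.                                          *)
pose push : {measure set (measurableTypeR R) -> \bar R} :=
  pushforward (mrestr mu mT) (@coordinate R n ord0).
pose nu : {measure set (measurableTypeR R) -> \bar R} :=
  mscale (NngNum Ki0) (push (measurable_coordinate ord0)).
have nuE A : measurable A -> lebesgue_measure A = nu A.
  apply: lebesgue_measure_unique => _ [[c d] _ <-] /=.
  rewrite /mscale/= /pushforward/= /mrestr/=.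
  have [dc|cd] := leP d c.
    by rewrite set_itv_ge ?bnd_simp -?leNgt// preimage_set0 set0I !measure0 mule0.
  pose a' : 'rV[R]_n.+1 := \row_i (if i == ord0 then c else a ord0 i).
  pose b' : 'rV[R]_n.+1 := \row_i (if i == ord0 then d else b ord0 i).
  rewrite (_ : _ `&` T = rect a' b' (fun i => if i == ord0 then false else lo i)
     (fun i => if i == ord0 then false else hi i)); last first.
    apply/seteqP; split => [x [/= xcd xT] i|x xr].
      by rewrite !mxE; case: eqP => [->//|/eqP /xT].
    split; first by have := xr ord0; rewrite !mxE eqxx.
    by move=> i /negbTE i0; have := xr i; rewrite !mxE i0.
  transitivity ((K^-1)%:E * (box_volume a' b')%:E)%E; last first.
    by congr (_ * _)%E; apply/esym/lebesgue_meas_rect => i; rewrite !mxE; case: eqP.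
  rewrite lebesgue_measure_itv/= lte_fin cd -EFinD -EFinM; congr EFin.
  rewrite /box_volume (bigD1 ord0)//= !mxE eqxx.
  under eq_bigr => i /negbTE i0 do rewrite !mxE i0.
  by rewrite -/K mulrCA mulVf ?mulr1// gt_eqF.
have -> : rect a b lo hi = coordinate ord0 @^-1` [set` side ord0] `&` T.
  apply/seteqP; split => [x xr|x [/= x0 xT] i]; first by split; [exact: xr|move=> i _; exact: xr].
  by case: (eqVneq i ord0) => [->|/xT].
have mS : measurable (coordinate ord0 @^-1` [set` side ord0] : set X).
  by rewrite -[X in measurable X]setTI; apply: measurable_coordinate => //; exact: measurable_itv.
rewrite -[LHS](@ge0_integral_mrestr _ _ _ mu _ (coordinate ord0 @^-1` [set` side ord0]) mT
   (h \o coordinate ord0) mS); last 2 first.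
- by apply: measurable_funTS; apply: measurableT_comp => //; exact: measurable_coordinate.
- by move=> x _ /=.
rewrite -(ge0_integral_pushforward (@measurable_coordinate R n ord0))//; last first.
  exact: measurable_funTS.
have mh' D : measurable_fun (D : set (measurableTypeR R)) h by exact: measurable_funTS.
rewrite (@integral_itv_bndoo R _ _ h true false); last exact: mh'.
rewrite -(@integral_itv_bndoo R _ _ h (lo ord0) (hi ord0)); last exact: mh'.
rewrite [X in (_ = _ * X)%E](eq_measure_integral nu); last by move=> A mA _; exact: nuE.
rewrite ge0_integral_mscale//.
by rewrite muleA -EFinM /= mulfV ?mul1e// gt_eqF.
Qed.

End rect_integral.

(** * Inequalities for real powers *)

Section powR_inequalities.
Context {R : realType}.
Implicit Types p q x y z : R.

(** With s = ln y, apply exp x >= 1 + x to both y = e^(qs) e^((1-q)s) and 1 = e^(qs) e^(-qs); in the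
    combination with weights q and 1 - q the linear terms cancel. *)
Lemma powR_concave_le q y : 0 <= q <= 1 -> 0 < y -> y `^ q <= 1 + q * (y - 1).
Proof.
move=> /andP[q0 q1] y0; pose s := ln y.
have yE : y = expR (q * s) * expR ((1 - q) * s).
  by rewrite -expRD -mulrDl addrC subrK mul1r lnK// posrE.
have oneE : 1 = expR (q * s) * expR (- (q * s)) by rewrite -expRD subrr expR0.
have yqE : y `^ q = expR (q * s) by rewrite /powR gt_eqF.
have e0 : 0 < expR (q * s) by exact: expR_gt0.
have h1 : expR (q * s) * (1 + (1 - q) * s) <= y.
  by rewrite [leRHS]yE ler_pM2l// expR_ge1Dx.
have h2 : expR (q * s) * (1 - q * s) <= 1.
  by rewrite [leRHS]oneE ler_pM2l// expR_ge1Dx.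
rewrite yqE.
have : q * (expR (q * s) * (1 + (1 - q) * s)) <= q * y by rewrite ler_wpM2l.
have : (1 - q) * (expR (q * s) * (1 - q * s)) <= (1 - q) * 1 by rewrite ler_wpM2l// subr_ge0.
lra.
Qed.

(** The quadratic gain comes from s = sqrt(1 + z) <= 1 + z/2 - z^2/16. It is transferred by the
    tangent inequality, applied to s with exponent 2q if q <= 1/2, and otherwise to 1/s with
    exponent 2(1 - q). *)
Lemma powR_concave_lt q z : 0 < q < 1 -> `|z| <= 2^-1 ->
  (1 + z) `^ q <= 1 + q * z - q * (1 - q) / 8 * z ^+ 2.
Proof.
move=> /andP[q0 q1]; rewrite ler_norml => /andP[z1 z2].
have y0 : 0 < 1 + z by lra.
pose s := (1 + z) `^ 2^-1.
have s0 : 0 < s by exact: powR_gt0.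
have s2 : s * s = 1 + z.
  by rewrite /s -powRD; [rewrite -div1r -splitr powRr1// ltW|rewrite gt_eqF// implybT].
have sle : s <= 1 + z / 2 - z ^+ 2 / 16.
  have r0 : 0 <= 1 + z / 2 - z ^+ 2 / 16 by nra.
  rewrite -ler_sqr ?nnegrE ?(ltW s0)// [s ^+ 2]expr2 s2.
  nra.
have [qh|qh] := leP q 2^-1.
  have -> : (1 + z) `^ q = s `^ (2 * q) by rewrite -powRrM mulrA mulVf ?mul1r.
  have h : 0 <= 2 * q <= 1 by apply/andP; split; lra.
  apply: (le_trans (powR_concave_le h s0)); nra.
have -> : (1 + z) `^ q = (1 + z) * s^-1 `^ (2 * (1 - q)).
  rewrite -powR_inv1 ?(ltW s0)// -powRrM -powRrM.
  rewrite -{2}(powRr1 (ltW y0)) -powRD; last by apply/implyP => _; rewrite gt_eqF.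
  by congr (_ `^ _); lra.
have h : 0 <= 2 * (1 - q) <= 1 by apply/andP; split; lra.
have si : 0 < s^-1 by rewrite invr_gt0.
have := powR_concave_le h si; rewrite -(ler_pM2l y0) => /le_trans; apply.
have ysi : (1 + z) * s^-1 = s by rewrite -s2 mulfK ?gt_eqF.
have -> : (1 + z) * (1 + 2 * (1 - q) * (s^-1 - 1)) =
    1 + z + 2 * (1 - q) * ((1 + z) * s^-1 - (1 + z)) by lra.
have q1' : 0 <= 1 - q by lra.
rewrite ysi; have := ler_wpM2l q1' sle.
have : 0 <= (1 - q) * (1 - q) * z ^+ 2 by apply: mulr_ge0; [exact: mulr_ge0|exact: sqr_ge0].
lra.
Qed.

Lemma powR_add_le p x y : 0 <= p -> 0 <= x -> 0 <= y ->
  (x + y) `^ p <= 2 `^ p * (x `^ p + y `^ p).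
Proof.
move=> p0; wlog xy : x y / x <= y => [H x0 y0|x0 y0].
  have [/H|/ltW /H] := leP x y; first exact.
  by rewrite addrC [X in _ * X]addrC; exact.
apply: (@le_trans _ _ ((2 * y) `^ p)).
  by rewrite ge0_ler_powR// ?nnegrE ?addr_ge0 ?mulr_ge0//; lra.
by rewrite powRM// ler_wpM2l ?powR_ge0// lerDr powR_ge0.
Qed.

Lemma powR_superadd p x y : 1 <= p -> 0 <= x -> 0 <= y ->
  x `^ p + y `^ p <= (x + y) `^ p.
Proof.
move=> p1 x0 y0; have p0 : 0 < p by exact: lt_le_trans p1.
have pm : 0 <= p - 1 by rewrite subr_ge0.
rewrite -(mulr_powRB1 x0 p0) -(mulr_powRB1 y0 p0) -(mulr_powRB1 (addr_ge0 x0 y0) p0).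
by rewrite mulrDl; apply: lerD; rewrite ler_wpM2l// ge0_ler_powR// ?nnegrE ?addr_ge0// ?lerDl ?lerDr.
Qed.

(** Applied to the u_k, this bounds the sum of the v_k by the p-th power of the sum of the u_k. *)
Lemma powR_superadd_sum p (I : Type) (r : seq I) (F : I -> R) : 1 <= p ->
  (forall i, 0 <= F i) -> \sum_(i <- r) F i `^ p <= (\sum_(i <- r) F i) `^ p.
Proof.
move=> p1 F0; elim: r => [|i r IH]; first by rewrite !big_nil powR_ge0.
rewrite !big_cons; apply: le_trans (powR_superadd p1 _ _) => //.
  by rewrite lerD2l.
by apply: sumr_ge0.
Qed.

End powR_inequalities.

(** * Means over intervals *)

Section interval_mean.
Context {R : realType}.
Implicit Types (h w : R -> R) (c l : R).

Definition mean c l h : R := l^-1 * (\int[lebesgue_measure]_(t in `[c, (c + l)%R]) h t)%R.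

Definition loc_integrable h := forall c l,
  lebesgue_measure.-integrable `[c, (c + l)%R] (EFin \o h).

Lemma continuous_loc_integrable h : continuous h -> loc_integrable h.
Proof.
move=> ch c l; apply: continuous_compact_integrable; first exact: segment_compact.
exact: continuous_subspaceT.
Qed.

Lemma cst_loc_integrable (r : R) : loc_integrable (fun=> r).
Proof. by apply: continuous_loc_integrable => x; exact: cvg_cst. Qed.

Lemma loc_integrableD h1 h2 : loc_integrable h1 -> loc_integrable h2 ->
  loc_integrable (fun t => h1 t + h2 t).
Proof.
by move=> i1 i2 c l; rewrite (_ : EFin \o _ = (EFin \o h1) \+ (EFin \o h2))%E//; exact: integrableD.
Qed.

Lemma loc_integrableZ (r : R) h : loc_integrable h -> loc_integrable (fun t => r * h t).
Proof.
move=> i1 c l; rewrite (_ : EFin \o _ = (fun t => r%:E * (EFin \o h) t))%E//.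
exact: integrableZl.
Qed.

Lemma loc_integrableB h1 h2 : loc_integrable h1 -> loc_integrable h2 ->
  loc_integrable (fun t => h1 t - h2 t).
Proof.
by move=> i1 i2 c l; rewrite (_ : EFin \o _ = (EFin \o h1) \- (EFin \o h2))%E//; exact: integrableB.
Qed.

Lemma loc_integrable_norm h : loc_integrable h -> loc_integrable (fun t => `|h t|).
Proof. by move=> i1 c l; exact: integrable_norm. Qed.

Lemma loc_integrable_sum (I : Type) (r : seq I) (F : I -> R -> R) :
  (forall i, loc_integrable (F i)) -> loc_integrable (fun t => \sum_(i <- r) F i t).
Proof.
move=> iF; elim: r => [|i r IH].
  by under eq_fun do rewrite big_nil; exact: cst_loc_integrable.
by under eq_fun do rewrite big_cons; exact: loc_integrableD.
Qed.

Lemma meanD c l h1 h2 : loc_integrable h1 -> loc_integrable h2 ->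
  mean c l (fun t => h1 t + h2 t) = mean c l h1 + mean c l h2.
Proof. by move=> i1 i2; rewrite /mean RintegralD// mulrDr. Qed.

Lemma meanB c l h1 h2 : loc_integrable h1 -> loc_integrable h2 ->
  mean c l (fun t => h1 t - h2 t) = mean c l h1 - mean c l h2.
Proof. by move=> i1 i2; rewrite /mean RintegralB// mulrBr. Qed.

Lemma meanZ c l (r : R) h : loc_integrable h ->
  mean c l (fun t => r * h t) = r * mean c l h.
Proof. by move=> i1; rewrite /mean RintegralZl// mulrCA. Qed.

Lemma mean_cst c l (r : R) : 0 < l -> mean c l (fun=> r) = r.
Proof.
move=> l0; rewrite /mean Rintegral_cst//= lebesgue_measure_itv/= lte_fin ltrDl l0.
by rewrite -EFinD/= addrAC subrr add0r mulrC mulfK// gt_eqF.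
Qed.

Lemma mean_sum (I : Type) (r : seq I) c l (F : I -> R -> R) : 0 < l ->
  (forall i, loc_integrable (F i)) ->
  mean c l (fun t => \sum_(i <- r) F i t) = \sum_(i <- r) mean c l (F i).
Proof.
move=> l0 iF; elim: r => [|i r IH].
  by under eq_fun do rewrite big_nil; rewrite big_nil mean_cst.
under eq_fun do rewrite big_cons; rewrite big_cons meanD ?IH//.
exact: loc_integrable_sum.
Qed.

Lemma le_mean c l h1 h2 : 0 < l -> loc_integrable h1 -> loc_integrable h2 ->
  (forall t, c <= t <= c + l -> h1 t <= h2 t) -> mean c l h1 <= mean c l h2.
Proof.
by move=> l0 i1 i2 h12; rewrite /mean ler_pM2l ?invr_gt0//; apply: le_Rintegral.
Qed.

Lemma mean_ge0 c l h : 0 < l -> (forall t, 0 <= h t) -> 0 <= mean c l h.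
Proof.
by move=> l0 h0; apply: mulr_ge0; [rewrite invr_ge0 ltW|apply: Rintegral_ge0].
Qed.

Lemma norm_mean_le c l h : 0 < l -> loc_integrable h ->
  `|mean c l h| <= mean c l (fun t => `|h t|).
Proof.
move=> l0 ih; rewrite /mean normrM gtr0_norm ?invr_gt0// ler_pM2l ?invr_gt0//.
exact: le_normr_Rintegral.
Qed.

(** Integrate the tangent inequality of [powR_concave_le] at the mean of [w]; the lower bound of [w]
    keeps that mean positive. *)
Lemma mean_jensen q c l w : 0 < q < 1 -> 0 < l -> continuous w ->
  continuous (fun t => w t `^ q) ->
  (exists2 m, 0 < m & forall t, m <= w t) ->
  mean c l (fun t => w t `^ q) <= mean c l w `^ q.
Proof.
move=> /andP[q0 q1] l0 cw cwq [m m0 mw].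
have iw := continuous_loc_integrable cw.
have iwq := continuous_loc_integrable cwq.
have M0 : 0 < mean c l w.
  by apply: (lt_le_trans m0); rewrite -[leLHS](mean_cst c m l0) le_mean//; exact: cst_loc_integrable.
set M := mean c l w in M0 *.
have Mq0 : 0 < M `^ q by exact: powR_gt0.
have icst := cst_loc_integrable.
have iw' : loc_integrable (fun t => M^-1 * w t - 1) by apply: loc_integrableB => //; exact: loc_integrableZ.
have iw2 : loc_integrable (fun t => q * (M^-1 * w t - 1)) by exact: loc_integrableZ.
have iw3 : loc_integrable (fun t => 1 + q * (M^-1 * w t - 1)) by exact: loc_integrableD.
apply: (@le_trans _ _ (mean c l (fun t => M `^ q * (1 + q * (M^-1 * w t - 1))))).
  apply: le_mean => //; first exact: loc_integrableZ.
  move=> t _; have wt0 : 0 < w t by exact: lt_le_trans (mw t).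
  have -> : w t = M * (M^-1 * w t) by rewrite mulVKf// gt_eqF.
  rewrite powRM ?(ltW M0)//; last by rewrite mulr_ge0 ?invr_ge0 ?ltW.
  rewrite ler_pM2l// mulVKf ?gt_eqF//; apply: powR_concave_le; first by rewrite !ltW.
  by rewrite mulr_gt0// invr_gt0.
rewrite meanZ// meanD// meanZ// meanB//; last exact: loc_integrableZ.
by rewrite meanZ// !mean_cst// -/M mulVf ?gt_eqF// subrr mulr0 addr0 mulr1.
Qed.

(** A class that admits integration by parts against cosines with uniform error. Being stable under
    products and dilations, it contains the Riesz products and their q-th powers. *)
Definition C1_bounded w := exists (w' : R -> R) (B : R),
  [/\ forall t : R, is_derive t 1 w (w' t), continuous w',
      forall t, `|w t| <= B & forall t, `|w' t| <= B].

Lemma C1_bounded_continuous w : C1_bounded w -> continuous w.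
Proof.
move=> [w' [B [dw _ _ _]]] t; apply: differentiable_continuous.
by apply/derivable1_diffP; have [] := dw t.
Qed.

Lemma C1_bounded_lipschitz w : C1_bounded w ->
  exists2 B, 0 <= B & forall x y, `|w x - w y| <= B * `|x - y|.
Proof.
move=> Cw; have cw := C1_bounded_continuous Cw; case: Cw => w' [B [dw _ _ w'B]].
exists B; first exact: le_trans (w'B 0).
move=> x y; wlog yx : x y / y <= x => [H|].
  by have [/H//|/ltW/H] := leP y x; rewrite distrC (distrC x).
have [z _ ->] := MVT_segment yx (fun z _ => dw z) (continuous_subspaceT cw).
by rewrite normrM ler_wpM2r.
Qed.

Lemma C1_bounded_cst (r : R) : C1_bounded (fun=> r).
Proof.
exists (fun=> 0), `|r|; split => //; last by move=> t; rewrite normr0.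
  by move=> t; exact: is_derive_cst.
by move=> t; exact: cvg_cst.
Qed.

Lemma C1_boundedM w1 w2 : C1_bounded w1 -> C1_bounded w2 ->
  C1_bounded (fun t => w1 t * w2 t).
Proof.
move=> C1 C2; have c1 := C1_bounded_continuous C1; have c2 := C1_bounded_continuous C2.
case: C1 => w1' [B1 [d1 c1' b1 b1']]; case: C2 => w2' [B2 [d2 c2' b2 b2']].
have B10 : 0 <= B1 by exact: le_trans (b1 0).
have B20 : 0 <= B2 by exact: le_trans (b2 0).
exists (fun t => w1 t * w2' t + w2 t * w1' t), (B1 * B2 + B2 * B1); split.
- by move=> t; exact: is_deriveM.
- by move=> t; apply: cvgD; apply: cvgM; [exact: c1|exact: c2'|exact: c2|exact: c1'].
- move=> t; rewrite normrM (le_trans (ler_pM _ _ (b1 t) (b2 t)))// lerDl.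
  exact: mulr_ge0.
- move=> t; rewrite (le_trans (ler_normD _ _))// !normrM.
  by apply: lerD; apply: ler_pM.
Qed.

Lemma C1_bounded_dilate (N : R) w : C1_bounded w -> C1_bounded (fun t => w (N * t)).
Proof.
case=> w' [B [dw cw' b b']].
have B0 : 0 <= B by exact: le_trans (b 0).
have cN : continuous (fun t : R => N * t) by move=> t; exact: mulrl_continuous.
exists (fun t => w' (N * t) * N), (B + B * `|N|); split.
- move=> t; apply: (@is_derive1_comp _ w (fun t => N * t)).
  by have := is_deriveZ N (is_derive_id t 1); rewrite [X in is_derive _ _ _ X]mulr1.
- move=> t; apply: cvgM; last exact: cvg_cst.
  by apply: (@continuous_comp _ _ _ (fun t => N * t) w'); [exact: cN|exact: cw'].
- by move=> t; rewrite (le_trans (b _))// lerDl mulr_ge0.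
- by move=> t; rewrite normrM (le_trans (ler_wpM2r _ (b' _)))// lerDr.
Qed.

End interval_mean.

(** * Riesz products *)

Section riesz_factor.
Context {R : realType}.
Implicit Types (w : R -> R) (q t c l : R).

Definition riesz t : R := 1 + 2^-1 * cos t.

Lemma riesz_ge t : 2^-1 <= riesz t.
Proof. by rewrite /riesz; have := cos_geN1 t; lra. Qed.

Lemma riesz_gt0 t : 0 < riesz t.
Proof. by apply: lt_le_trans (riesz_ge t); rewrite invr_gt0. Qed.

Lemma riesz_le t : riesz t <= 2.
Proof. by rewrite /riesz; have := cos_le1 t; lra. Qed.

Lemma is_derive_riesz t : is_derive t 1 riesz (- (2^-1 * sin t)).
Proof.
have := is_deriveD (is_derive_cst (1 : R) t (1 : R)) (is_deriveZ (2^-1 : R) (is_derive_cos t)).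
by rewrite add0r -mulrN.
Qed.

Lemma C1_bounded_riesz : C1_bounded riesz.
Proof.
exists (fun t => - (2^-1 * sin t)), 2; split.
- exact: is_derive_riesz.
- by move=> t; apply: cvgN; apply: cvgM; [exact: cvg_cst|exact: continuous_sin].
- by move=> t; rewrite ger0_norm ?riesz_le// ltW// riesz_gt0.
- by move=> t; rewrite ler_norml; have := sin_geN1 t; have := sin_le1 t; lra.
Qed.

(** With z = cos t / 2 in [powR_concave_lt], the identity cos^2 t = (1 + cos 2t)/2 turns the
    quadratic gain into a constant drop plus an oscillating term. *)
Lemma riesz_powR_le q t : 0 < q < 1 ->
  riesz t `^ q <= (1 - q * (1 - q) / 64) + q / 2 * cos t - q * (1 - q) / 64 * cos (2 * t).
Proof.
move=> q01; have z : `|2^-1 * cos t| <= 2^-1.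
  by rewrite ler_norml; have := cos_geN1 t; have := cos_le1 t; lra.
apply: (le_trans (powR_concave_lt q01 z)).
have -> : cos (2 * t) = 2 * cos t ^+ 2 - 1.
  by rewrite mulr_natl cos_mulr2n mulr_natl.
lra.
Qed.

Lemma C1_bounded_riesz_powR q : 0 < q < 1 -> C1_bounded (fun t => riesz t `^ q).
Proof.
move=> q01; have /andP[q0 q1] := q01.
have cr := C1_bounded_continuous C1_bounded_riesz.
have E : (fun t => riesz t `^ q) = (fun t => expR (q * ln (riesz t))).
  by apply/funext => t; rewrite /powR gt_eqF// riesz_gt0.
have dE t : is_derive t 1 (fun t => riesz t `^ q)
    (riesz t `^ q * (q * (- (2^-1 * sin t) / riesz t))).
  rewrite [X in is_derive _ _ X]E [X in X * _](_ : _ = expR (q * ln (riesz t))); last first.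
    by rewrite /powR gt_eqF// riesz_gt0.
  apply: (@is_derive1_comp _ expR (fun t => q * ln (riesz t))).
  apply: is_deriveZ; rewrite mulrC.
  apply: (@is_derive1_comp _ (@ln R) riesz); last exact: is_derive_riesz.
  exact/is_derive1_ln/riesz_gt0.
have cE : continuous (fun t => riesz t `^ q).
  move=> t; apply: differentiable_continuous.
  by apply/derivable1_diffP; have [] := dE t.
have b2 t : `|riesz t `^ q| <= 2.
  have q01' : 0 <= q <= 1 by rewrite !ltW.
  rewrite ger0_norm ?powR_ge0//; have := powR_concave_le q01' (riesz_gt0 t).
  by have := ler_wpM2l (ltW q0) (riesz_le t); lra.
exists (fun t => riesz t `^ q * (q * (- (2^-1 * sin t) / riesz t))), 2; split => //.
- move=> t; apply: cvgM; first exact: cE.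
  apply: cvgM; first exact: cvg_cst.
  apply: cvgM; first by apply: cvgN; apply: cvgM; [exact: cvg_cst|exact: continuous_sin].
  by apply: cvgV; [rewrite gt_eqF// riesz_gt0|exact: cr].
- move=> t; rewrite normrM -[leRHS]mulr1; apply: ler_pM => //.
  rewrite normrM (gtr0_norm q0) -[leRHS]mulr1; apply: ler_pM => //; [exact: ltW|exact: ltW|].
  rewrite normrM normfV ler_pdivrMr ?normr_gt0 ?gt_eqF ?riesz_gt0// mul1r.
  rewrite (gtr0_norm (riesz_gt0 t)) normrN (le_trans _ (riesz_ge t))//.
  by rewrite ler_norml; have := sin_geN1 t; have := sin_le1 t; lra.
Qed.

(* Integrating by parts against the primitive sin (N t) / N.                  *)
Lemma mean_cos_small w (d e : R) : C1_bounded w -> 0 < d -> 0 < e ->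
  exists2 M, 0 < M & forall N c l, M <= N -> d <= l ->
    `|mean c l (fun t => w t * cos (N * t))| <= e.
Proof.
move=> Cw d0 e0; have cw := C1_bounded_continuous Cw.
case: Cw => w' [B [dw cw' b b']].
have B0 : 0 <= B by exact: le_trans (b 0).
(* 2B/(dN) will bound the boundary terms divided by the length l >= d, and B/N the remaining mean; a
   frequency above this quotient makes their sum at most e. *)
have K0 : 0 <= (2 * B / d + B) / e.
  apply: divr_ge0; last exact: ltW.
  by apply: addr_ge0 => //; apply: divr_ge0; [exact: mulr_ge0|exact: ltW].
exists ((2 * B / d + B) / e + 1) => [|N c l MN dl]; first by lra.
have l0 : 0 < l by exact: lt_le_trans dl.
have N0 : 0 < N by lra.
pose G t := N^-1 * sin (N * t).
have dG t : is_derive t 1 G (cos (N * t)).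
  have -> : cos (N * t) = N^-1 * (cos (N * t) * N) by rewrite mulrCA mulVf ?mulr1// gt_eqF.
  apply: is_deriveZ; apply: (@is_derive1_comp _ (@sin R) (fun t => N * t)).
  by have := is_deriveZ N (is_derive_id t 1); rewrite [X in is_derive _ _ _ X]mulr1.
have cN : continuous (fun t : R => N * t) by move=> t; exact: mulrl_continuous.
have cG : continuous G.
  move=> t; apply: differentiable_continuous.
  by apply/derivable1_diffP; have [] := dG t.
have ccos : continuous (fun t => cos (N * t)).
  by move=> t; apply: (@continuous_comp _ _ _ (fun t => N * t) (@cos R)); [exact: cN|exact: continuous_cos].
have GB t : `|G t| <= N^-1.
  rewrite /G normrM gtr0_norm ?invr_gt0// ler_piMr ?invr_ge0 ?(ltW N0)//.
  by rewrite ler_norml sin_geN1 sin_le1.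
have lr (f f' : R -> R) : (forall t : R, is_derive t 1 f (f' t)) -> continuous f ->
    derivable_oo_LRcontinuous f c (c + l).
  move=> df cf; split; first by move=> t _; have [] := df t.
    exact/cvg_at_right_filter/cf.
  exact/cvg_at_left_filter/cf.
have := @Rintegration_by_parts R w G w' (fun t => cos (N * t)) c (c + l).
rewrite ltrDl l0 => /(_ isT (continuous_subspaceT cw') (lr _ _ dw cw)).
have E1 (f f' : R -> R) : (forall t : R, is_derive t 1 f (f' t)) -> {in `]c, c + l[, f^`()%classic =1 f'}.
  by move=> df t _; rewrite derive1E; have [_] := df t.
move=> /(_ (E1 _ _ dw) (continuous_subspaceT ccos) (lr _ _ dG cG) (E1 _ _ dG)).
move=> IP; rewrite {1}/mean IP.
rewrite mulrBr.
have -> : l^-1 * (\int[lebesgue_measure]_(x in `[c, (c + l)%R]) (w' x * G x))%R =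
  mean c l (fun x => w' x * G x) by [].
have iwG : loc_integrable (fun x => w' x * G x).
  by apply: continuous_loc_integrable => t; apply: cvgM; [exact: cw'|exact: cG].
have h1 : `|mean c l (fun x => w' x * G x)| <= B * N^-1.
  apply: (le_trans (norm_mean_le _ l0 iwG)).
  rewrite -[leRHS](mean_cst c _ l0); apply: le_mean => //.
  - exact: loc_integrable_norm.
  - exact: cst_loc_integrable.
  - by move=> t _; rewrite normrM; apply: ler_pM.
have h2 : `|l^-1 * (w (c + l) * G (c + l) - w c * G c)| <= 2 * B / d * N^-1.
  rewrite normrM gtr0_norm ?invr_gt0//.
  have : `|w (c + l) * G (c + l) - w c * G c| <= 2 * (B * N^-1).
    rewrite (le_trans (ler_normB _ _))// (normrM (w (c + l))) (normrM (w c)) mulr_natl mulr2n.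
    by apply: lerD; apply: ler_pM.
  move=> H; apply: (@le_trans _ _ (d^-1 * (2 * (B * N^-1)))); last by lra.
  by apply: ler_pM => //; rewrite ?invr_ge0 ?(ltW l0)// lef_pV2.
apply: (le_trans (ler_normB _ _)); apply: (le_trans (lerD h2 h1)).
rewrite -mulrDl ler_pdivrMr//.
have : (2 * B / d + B) / e <= N by lra.
by rewrite ler_pdivrMr// [N * e]mulrC.
Qed.

End riesz_factor.

(** * Inductive construction of the scales and frequencies *)

Section riesz_products.
Context {R : realType}.
Implicit Types (u v w : R -> R) (q t c l d e : R).

(** Once the new factor is expanded, the errors are means of v cos(Nt), v^q cos(Nt) and v^q
    cos(2Nt), which [mean_cos_small] makes small on all intervals of length at least [d] at once. *)
Lemma riesz_step q v d e : 0 < q < 1 ->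
  C1_bounded v -> C1_bounded (fun t => v t `^ q) ->
  0 < d -> 0 < e ->
  exists N, forall c l, d <= l ->
    `|mean c l (fun t => v t * riesz (N * t)) - mean c l v| <= e /\
    mean c l (fun t => v t `^ q * riesz (N * t) `^ q) <=
      (1 - q * (1 - q) / 64) * mean c l (fun t => v t `^ q) + e.
Proof.
move=> q01 Cv Cu d0 e0; have /andP[q0 q1] := q01.
have e20 : 0 < e / 2 by rewrite divr_gt0.
have [M1 M10 mix1] := mean_cos_small Cv d0 e0.
have [M2 M20 mix2] := mean_cos_small Cu d0 e20.
pose N := M1 + M2.
exists N => c l dl; have l0 : 0 < l by exact: lt_le_trans dl.
have cN (a : R) : continuous (fun t : R => a * t) by move=> t; exact: mulrl_continuous.
have ccos (a : R) : continuous (fun t => cos (a * t)).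
  by move=> t; apply: (@continuous_comp _ _ _ (fun t => a * t) (@cos R)); [exact: cN|exact: continuous_cos].
have iM w1 w2 : continuous w1 -> continuous w2 -> loc_integrable (fun t => w1 t * w2 t).
  by move=> c1 c2; apply: continuous_loc_integrable => t; apply: cvgM; [exact: c1|exact: c2].
have cv := C1_bounded_continuous Cv; have cu := C1_bounded_continuous Cu.
have iv := continuous_loc_integrable cv; have iu := continuous_loc_integrable cu.
have N1 : M1 <= N by rewrite /N; lra.
have N2 : M2 <= N by rewrite /N; lra.
have N22 : M2 <= 2 * N by rewrite /N; lra.
split.
  have -> : mean c l (fun t => v t * riesz (N * t)) =
      mean c l v + 2^-1 * mean c l (fun t => v t * cos (N * t)).
    rewrite -meanZ; last exact: iM.
    rewrite -meanD//; last exact/loc_integrableZ/iM.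
    by congr (mean _ _ _); apply/funext => t; rewrite /riesz; lra.
  rewrite addrAC subrr add0r normrM.
  rewrite gtr0_norm ?invr_gt0//; have := mix1 N c l N1 dl.
  have := normr_ge0 (mean c l (fun t => v t * cos (N * t))); lra.
set k := q * (1 - q) / 64.
have k0 : 0 <= k <= 1 by rewrite /k; apply/andP; split; nra.
have icos a : loc_integrable (fun t => v t `^ q * cos (a * t)) by exact: iM.
apply: (@le_trans _ _ (mean c l (fun t => (1 - k) * v t `^ q +
   (q / 2 * (v t `^ q * cos (N * t)) - k * (v t `^ q * cos (2 * N * t)))))).
  apply: le_mean => //.
  - have := C1_boundedM Cu (C1_bounded_dilate N (C1_bounded_riesz_powR q01)).
    by move/C1_bounded_continuous/continuous_loc_integrable.
  - apply: loc_integrableD; first exact: loc_integrableZ.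
    by apply: loc_integrableB; exact: loc_integrableZ.
  - move=> t _; have := ler_wpM2l (powR_ge0 (v t) q) (riesz_powR_le (N * t) q01).
    by rewrite -[2 * N * t]mulrA /k; lra.
rewrite meanD; [|exact: loc_integrableZ|by apply: loc_integrableB; exact: loc_integrableZ].
rewrite meanZ// meanB; [|exact: loc_integrableZ|exact: loc_integrableZ].
rewrite !meanZ//.
have := mix2 N c l N2 dl; have := mix2 (2 * N) c l N22 dl.
rewrite !ler_norml => /andP[h1 h2] /andP[h3 h4].
move: k0 => /andP[k0 k1].
rewrite lerD2l; set x := mean c l _ in h3 h4 *; set y := mean c l _ in h1 h2 *.
have : q / 2 * x <= q / 2 * (e / 2) by rewrite ler_wpM2l// divr_ge0// ltW.
have : - k * y <= k * (e / 2).
  by rewrite mulNr -mulrN ler_wpM2l// lerNl.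
nra.
Qed.

(** Dependent choice. At each step the scale comes first, small enough for u_k to be nearly constant
    on it; the frequency of the next factor comes afterwards, large enough for that scale. *)
Lemma riesz_products q L : 0 < q < 1 -> 0 < L ->
  exists (v : nat -> R -> R) (d : nat -> R), forall k,
  [/\ C1_bounded (v k) /\ C1_bounded (fun t => v k t `^ q),
      (exists2 m, 0 < m & forall t, m <= v k t) /\ v 0%N = (fun=> 1),
      [/\ 0 < d k, d k <= L, d k.+1 <= d k & d k.+1 <= 2^-1 ^+ k],
      forall t t', `|t - t'| <= d k.+1 -> `|v k t `^ q - v k t' `^ q| <= 2^-1 ^+ k &
      forall c l, d k.+1 <= l ->
        `|mean c l (v k.+1) - mean c l (v k)| <= 2^-1 ^+ k.+2 /\
        mean c l (fun t => v k.+1 t `^ q) <=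
        (1 - q * (1 - q) / 64) * mean c l (fun t => v k t `^ q) + 2^-1 ^+ k.+1].
Proof.
move=> q01 L0.
(* The index is part of the state, because the error allowed at a step depends on it. *)
pose P (s : (R -> R) * R * nat) := [/\ C1_bounded s.1.1, C1_bounded (fun t => s.1.1 t `^ q),
  exists2 m, 0 < m & forall t, m <= s.1.1 t & 0 < s.1.2 <= L].
pose rel (x y : {s | P s}) := let: (v, d, k) := sval x in let: (v', d', k') := sval y in
  [/\ k' = k.+1, d' <= d /\ d' <= 2^-1 ^+ k,
      forall t t', `|t - t'| <= d' -> `|v t `^ q - v t' `^ q| <= 2^-1 ^+ k &
      forall c l, d' <= l ->
        `|mean c l v' - mean c l v| <= 2^-1 ^+ k.+2 /\
        mean c l (fun t => v' t `^ q) <=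
        (1 - q * (1 - q) / 64) * mean c l (fun t => v t `^ q) + 2^-1 ^+ k.+1].
have p2 k : 0 < 2^-1 ^+ k :> R by rewrite exprn_gt0.
have step x : {y | rel x y}.
  apply: cid; case: x => -[[v d] k] Px; have [/= Cv Cu [m m0 vm] /andP[d0 dL]] := Px.
  have [B B0 lip] := C1_bounded_lipschitz Cu.
  (* [B] is a Lipschitz constant of v^q, so the last term makes v^q vary by at most 2^-k over the
     length [d']. *)
  pose d' := Num.min (Num.min d (2^-1 ^+ k)) (2^-1 ^+ k / (B + 1)).
  have B10 : 0 < B + 1 by rewrite ltr_wpDl.
  have d'0 : 0 < d' by rewrite !lt_min d0 p2 divr_gt0.
  have e0 : 0 < 2^-1 ^+ k.+2 :> R by [].
  have [N HN] := riesz_step q01 Cv Cu d'0 e0.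
  have rp t : 0 < riesz (N * t) by exact: riesz_gt0.
  have vp t : 0 < v t by exact: lt_le_trans (vm t).
  have qE : (fun t => (v t * riesz (N * t)) `^ q) = (fun t => v t `^ q * riesz (N * t) `^ q).
    by apply/funext => t; rewrite powRM// ltW.
  have Py : P (fun t => v t * riesz (N * t), d', k.+1).
    split => /=.
    - exact: C1_boundedM Cv (C1_bounded_dilate N C1_bounded_riesz).
    - rewrite qE; exact: C1_boundedM Cu (C1_bounded_dilate N (C1_bounded_riesz_powR q01)).
    - exists (m * 2^-1); first by rewrite mulr_gt0.
      by move=> t; apply: ler_pM => //; [exact: ltW|exact: riesz_ge].
    - by rewrite d'0 /= /d' !ge_min dL.
  exists (exist _ _ Py) => /=; split => //.
  - by rewrite /d' !ge_min !lexx orbT.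
  - move=> t t' tt'; apply: (le_trans (lip t t')).
    have : `|t - t'| <= 2^-1 ^+ k / (B + 1) by apply: (le_trans tt'); rewrite /d' ge_min lexx orbT.
    rewrite ler_pdivlMr// => h; apply: le_trans h.
    by rewrite mulrC ler_wpM2l// lerDl.
  - move=> c l dl; have [h1 h2] := HN c l dl; split => //.
    rewrite qE; apply: (le_trans h2); rewrite lerD2l.
    by rewrite exprS ler_piMl ?ltW// invf_lt1// ltr1n.
have P0 : P (fun=> 1, L, 0%N).
  split => /=; [exact: C1_bounded_cst|exact: C1_bounded_cst|by exists 1|by rewrite L0 lexx].
have [f [f0 fS]] := dependent_choice step (exist _ _ P0).
exists (fun k => (sval (f k)).1.1), (fun k => (sval (f k)).1.2) => k.
have fk i : (sval (f i)).2 = i.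
  elim: i => [|i IH]; first by rewrite f0.
  move: (fS i); rewrite /rel; move: IH.
  by case: (sval (f i)) => -[v d] j /= ->; case: (sval (f i.+1)) => -[v' d'] j' /= [-> _ _ _].
have := svalP (f k); have := fS k; have := fk k; rewrite /rel /P.
case: (sval (f k)) => -[v d] j /= ->; case: (sval (f k.+1)) => -[v' d'] j' /= [_ [dd dk] lip mix].
by case=> Cv Cu vm /andP[d0 dL]; split => //; split => //; rewrite f0.
Qed.

End riesz_products.

(** * The example on the line *)

Section series_of_functions.
Context {R : realType}.
Implicit Types (u v : nat -> R -> R) (a t c l d : R).

Lemma geometric_half_le n : \sum_(i < n) 2^-1 ^+ i <= 2 :> R.
Proof.
suff -> : \sum_(i < n) 2^-1 ^+ i = 2 - 2 * 2^-1 ^+ n :> R.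
  by rewrite gerBl mulr_ge0// exprn_ge0.
elim: n => [|n IH]; first by rewrite big_ord0 expr0; lra.
by rewrite big_ord_recr/= IH exprS; lra.
Qed.

(** The bound is the fixed point of T = F 0 + 1 + a T, the recursion that dominates the partial
    sums. *)
Lemma contracting_sum_le a (F : nat -> R) n : 0 <= a < 1 -> (forall i, 0 <= F i) ->
  (forall i, F i.+1 <= a * F i + 2^-1 ^+ i.+1) ->
  \sum_(i < n) F i <= (F 0%N + 1) / (1 - a).
Proof.
move=> /andP[a0 a1] F0 FS; have a10 : 0 < 1 - a by rewrite subr_gt0.
elim: n => [|n IH]; first by rewrite big_ord0; apply: divr_ge0; [exact: addr_ge0|exact: ltW].
rewrite big_ord_recl/=.
have : \sum_(i < n) F (bump 0 i) <= a * \sum_(i < n) F i + 1.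
  apply: (@le_trans _ _ (\sum_(i < n) (a * F i + 2^-1 ^+ i.+1))).
    by apply: ler_sum => i _; exact: FS.
  rewrite big_split/= -mulr_sumr lerD2l.
  under eq_bigr do rewrite exprS.
  by rewrite -mulr_sumr; have := geometric_half_le n; lra.
have aIH := ler_wpM2l a0 IH.
set K := (F 0%N + 1) / (1 - a) in IH aIH *.
have KE : K * (1 - a) = F 0%N + 1 by rewrite /K divfK// gt_eqF.
lra.
Qed.

(** [fine] gives the value 0 where the series diverges; in the example this is a null set, by
    [integrable_series_fun]. *)
Definition series_fun u t : R := fine (\sum_(k <oo) (u k t)%:E)%E.

Lemma series_fun_ge0 u t : (forall k t, 0 <= u k t) -> 0 <= series_fun u t.
Proof. by move=> u0; rewrite fine_ge0// nneseries_ge0// => k _ _; rewrite lee_fin. Qed.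

Lemma measurable_eseries_fun u : (forall k, continuous (u k)) -> (forall k t, 0 <= u k t) ->
  measurable_fun setT (fun t => (\sum_(k <oo) (u k t)%:E)%E).
Proof.
move=> cu u0; apply: ge0_emeasurable_sum => [k t _ _|k _]; first by rewrite lee_fin.
by apply/measurable_EFinP; exact: continuous_measurable_fun.
Qed.

Lemma measurable_series_fun u : (forall k, continuous (u k)) -> (forall k t, 0 <= u k t) ->
  measurable_fun setT (series_fun u).
Proof.
move=> cu u0; apply: (@measurableT_comp _ _ _ _ _ _ fine); first exact: fine_measurable.
exact: measurable_eseries_fun.
Qed.

(** The first j terms are off by at most the sum of the 2^-k, and the later ones count in full; if
    the tail is infinite, so is the right-hand side. *)
Lemma series_fun_dist_le u j (w : nat -> R) t : (forall k t, 0 <= u k t) ->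
  (forall k, (k < j)%N -> `|u k t - w k| <= 2^-1 ^+ k) ->
  (`|series_fun u t - \sum_(k < j) w k|%:E <= 2%:E + \sum_(i <oo) (u (i + j)%N t)%:E)%E.
Proof.
move=> u0 uw; have ue0 k : (0 <= (u k t)%:E)%E by rewrite lee_fin.
have T0 : (0 <= \sum_(i <oo) (u (i + j)%N t)%:E)%E by exact: nneseries_ge0.
rewrite /series_fun (nneseries_split 0 j)// add0n -(@nneseries_addn _ (fun k => (u k t)%:E))//.
move: T0; case: (\sum_(i <oo) (u (i + j)%N t)%:E)%E => [T|_|//]; last by rewrite [leRHS]addey// leey.
rewrite lee_fin => T0; rewrite big_mkord sumEFin -!EFinD lee_fin /=.
rewrite addrAC -sumrB (le_trans (ler_normD _ _))// (ger0_norm T0) lerD2r.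
rewrite (le_trans (ler_norm_sum _ _ _))// (le_trans _ (geometric_half_le j))//.
by apply: ler_sum => i _; exact: uw.
Qed.

Lemma mean_EFin c l (h : R -> R) : 0 < l -> loc_integrable h ->
  (\int[lebesgue_measure]_(t in `[c, (c + l)%R]) (h t)%:E = (l * mean c l h)%:E)%E.
Proof.
move=> l0 ih; rewrite /mean mulrA mulfV ?gt_eqF// mul1r fineK//.
exact: integrable_fin_num.
Qed.

(** After monotone convergence, the means of the tail terms obey the recursion of
    [contracting_sum_le]. *)
Lemma integral_tail_le u a j c l : 0 <= a < 1 -> 0 < l ->
  (forall k, continuous (u k)) -> (forall k t, 0 <= u k t) ->
  (forall k, (j <= k)%N -> mean c l (u k.+1) <= a * mean c l (u k) + 2^-1 ^+ k.+1) ->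
  (\int[lebesgue_measure]_(t in `[c, (c + l)%R]) \sum_(i <oo) (u (i + j)%N t)%:E <=
   (l * ((mean c l (u j) + 1) / (1 - a)))%:E)%E.
Proof.
move=> a01 l0 cu u0 uS; have iu k := continuous_loc_integrable (cu k).
rewrite integral_nneseries//; last 2 first.
- move=> k; apply/measurable_EFinP; apply: measurable_funTS.
  exact: continuous_measurable_fun.
- by move=> k t _; rewrite lee_fin.
under eq_eseriesr do rewrite mean_EFin//.
apply: lime_le.
  by apply: is_cvg_nneseries => k _ _; rewrite lee_fin mulr_ge0 ?(ltW l0)// mean_ge0.
apply: nearW => n; rewrite sumEFin lee_fin -mulr_sumr ler_pM2l// big_mkord.
apply: (@contracting_sum_le a (fun i => mean c l (u (i + j)%N))) => // i.
  by apply: mean_ge0.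
rewrite addSn; apply: (le_trans (uS _ (leq_addl _ _))); rewrite lerD2l addnC.
by rewrite -addnS exprD ler_piMl ?exprn_ge0// exprn_ile1// invf_le1// ler1n.
Qed.

Lemma integral_series_dist_le u a j (w : nat -> R) c l : 0 <= a < 1 -> 0 < l ->
  (forall k, continuous (u k)) -> (forall k t, 0 <= u k t) ->
  (forall k, (j <= k)%N -> mean c l (u k.+1) <= a * mean c l (u k) + 2^-1 ^+ k.+1) ->
  (forall k t, c <= t <= c + l -> (k < j)%N -> `|u k t - w k| <= 2^-1 ^+ k) ->
  (\int[lebesgue_measure]_(t in `[c, (c + l)%R]) `|series_fun u t - \sum_(k < j) w k|%:E <=
   (l * (2 + (mean c l (u j) + 1) / (1 - a)))%:E)%E.
Proof.
move=> a01 l0 cu u0 uS uw.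
have mT : measurable_fun setT (fun t => (\sum_(i <oo) (u (i + j)%N t)%:E)%E).
  exact: (@measurable_eseries_fun (fun i => u (i + j)%N)).
apply: (@le_trans _ _ (\int[lebesgue_measure]_(t in `[c, (c + l)%R])
   (2%:E + \sum_(i <oo) (u (i + j)%N t)%:E)))%E.
  apply: ge0_le_integral => //.
  - apply/measurable_EFinP; apply: measurable_funTS; apply: measurableT_comp => //.
    by apply: measurable_funB => //; exact: measurable_series_fun.
  - by apply: emeasurable_funD => //; exact: measurable_funTS.
  - by move=> t /=; rewrite in_itv/= => tc; apply: series_fun_dist_le => // k; exact: uw.
rewrite ge0_integralD//; last 2 first.
- by move=> t _; apply: nneseries_ge0 => k _ _; rewrite lee_fin.
- exact: measurable_funTS.
rewrite mulrDr [leRHS]EFinD; apply: leeD; last exact: integral_tail_le.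
rewrite mean_EFin ?mean_cst//; exact: cst_loc_integrable.
Qed.

End series_of_functions.

(** * Oscillation and lower bounds for the sum of the series *)

Section one_dimensional_example.
Context {R : realType}.
Implicit Types (a t c l d p q : R).

Lemma mean_oscillation_le c l (h : R -> R) (r : R) : 0 < l -> loc_integrable h ->
  mean c l (fun t => `|h t - mean c l h|) <= 2 * mean c l (fun t => `|h t - r|).
Proof.
move=> l0 ih; have icst := cst_loc_integrable.
have ihr r' : loc_integrable (fun t => h t - r') by exact: loc_integrableB.
have nhr r' : loc_integrable (fun t => `|h t - r'|) by exact: loc_integrable_norm.
have hr : `|mean c l h - r| <= mean c l (fun t => `|h t - r|).
  apply: le_trans (norm_mean_le c l0 (ihr r)).
  by rewrite meanB// mean_cst.
apply: (@le_trans _ _ (mean c l (fun t => `|h t - r| + `|mean c l h - r|))).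
  apply: le_mean => //; first exact: loc_integrableD.
  by move=> t _; rewrite (distrC (mean c l h)) (le_trans (ler_distD r _ _)).
by rewrite meanD// mean_cst// mulr_natl mulr2n lerD2l.
Qed.

Lemma loc_integrable_gt0 (h : R -> R) :
  (forall c l, 0 < l -> lebesgue_measure.-integrable `[c, (c + l)%R] (EFin \o h)) ->
  loc_integrable h.
Proof.
move=> ih c l; apply: (@integrableS _ _ _ (@lebesgue_measure R) `[c, (c + (`|l| + 1))%R]%classic) => //.
  apply: subset_itvl; rewrite bnd_simp lerD2l (le_trans (ler_norm l))// lerDl.
  exact: ler01.
by apply: ih; rewrite ltr_wpDl.
Qed.

Lemma integrable_series_fun (u : nat -> R -> R) a j c l : 0 <= a < 1 -> 0 < l ->
  (forall k, continuous (u k)) -> (forall k t, 0 <= u k t) ->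
  (forall k, (j <= k)%N -> mean c l (u k.+1) <= a * mean c l (u k) + 2^-1 ^+ k.+1) ->
  lebesgue_measure.-integrable `[c, (c + l)%R] (fun t => (\sum_(k <oo) (u k t)%:E)%E).
Proof.
move=> a01 l0 cu u0 uS.
apply/integrableP; split; first by apply: measurable_funTS; exact: measurable_eseries_fun.
under eq_integral => t _.
  rewrite gee0_abs; last by apply: nneseries_ge0 => k _ _; rewrite lee_fin.
  rewrite (nneseries_split 0 j); last by move=> k _; rewrite lee_fin.
  rewrite add0n -(@nneseries_addn _ (fun k => (u k t)%:E)); last by move=> k; rewrite lee_fin.
  rewrite sumEFin.
  over.
rewrite ge0_integralD//; last 4 first.
- by move=> t _; rewrite lee_fin sumr_ge0.
- apply/measurable_EFinP; apply: measurable_funTS; apply: measurable_sum => k.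
  exact: continuous_measurable_fun.
- by move=> t _; apply: nneseries_ge0 => k _ _; rewrite lee_fin.
- apply: measurable_funTS; exact: (@measurable_eseries_fun _ (fun i => u (i + j)%N)).
rewrite mean_EFin//; last first.
  by apply: loc_integrable_sum => k; exact: continuous_loc_integrable.
apply: lte_add_pinfty; first exact: ltry.
by apply: (le_lt_trans (integral_tail_le a01 l0 cu u0 uS)); exact: ltry.
Qed.

(** The pointwise inequality is available only almost everywhere, since [series_fun] is 0 where the
    series diverges; integrability of the extended sum makes that set null. *)
Lemma mean_partial_sum_le (u : nat -> R -> R) c l J : 0 < l ->
  (forall k, continuous (u k)) -> (forall k t, 0 <= u k t) ->
  lebesgue_measure.-integrable `[c, (c + l)%R] (fun t => (\sum_(k <oo) (u k t)%:E)%E) ->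
  loc_integrable (series_fun u) ->
  mean c l (fun t => \sum_(k < J) u k t) <= mean c l (series_fun u).
Proof.
move=> l0 cu u0 iU iphi.
rewrite -(ler_pM2l l0) -lee_fin -!mean_EFin//; last first.
  by apply: loc_integrable_sum => k; exact: continuous_loc_integrable.
apply: ae_ge0_le_integral => //.
- by move=> t _; rewrite lee_fin sumr_ge0.
- apply/measurable_EFinP; apply: measurable_funTS; apply: measurable_sum => k.
  exact: continuous_measurable_fun.
- by move=> t _; rewrite lee_fin series_fun_ge0.
- by apply/measurable_EFinP; apply: measurable_funTS; exact: measurable_series_fun.
have := integrable_ae _ iU => /(_ (measurable_itv _)).
apply: filterS => t Ut tc; rewrite /series_fun fineK; last exact: Ut.
rewrite -sumEFin -(big_mkord xpredT (fun k => (u k t)%:E)).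
by apply: nneseries_lim_ge => k _ _; rewrite lee_fin.
Qed.

(** Take the least j with d_(j+1) <= l: at length l the terms before j are nearly constant, and
    those from j on are in the contracting regime. *)
Lemma scale_level (d : nat -> R) l : 0 < l -> (forall k, d k.+1 <= 2^-1 ^+ k) ->
  exists j, d j.+1 <= l /\ forall k, (k < j)%N -> l <= d k.+1.
Proof.
move=> l0 dk.
have ex : exists j, d j.+1 <= l.
  exists (Num.bound l^-1); apply: (le_trans (dk _)).
  rewrite exprVn -[leRHS]invrK lef_pV2 ?posrE ?exprn_gt0 ?invr_gt0//.
  by apply: ltW; exact: upper_nthrootP.
case: (ex_minnP ex) => j dj jmin; exists j; split => // k kj.
by rewrite leNgt; apply/negP => /ltW /jmin; rewrite leqNgt kj.
Qed.

(** The oscillation bound is stated for all J >= j so that finitely many intervals can share one J.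
    The last two clauses together force the averages of phi on fine partitions to have unbounded
    p-th power sums. *)
Lemma one_dimensional_example p L : 1 < p -> 0 < L ->
  exists (phi : R -> R) (v : nat -> R -> R) (C : R),
  [/\ [/\ measurable_fun setT phi, forall t, 0 <= phi t & loc_integrable phi],
      [/\ 0 <= C, forall k, continuous (v k) & forall k t, 0 <= v k t],
      forall c l, 0 < l -> exists j, forall J, (j <= J)%N ->
        mean c l (fun t => `|phi t - mean c l phi|) `^ p <= C * (1 + mean c l (v J)),
      forall c l k, L <= l -> 2^-1 <= mean c l (v k) <= 2 &
      forall J, exists2 d, 0 < d & forall c l, 0 < l <= d ->
        \sum_(k < J) mean c l (v k) <= 2 `^ p * (mean c l phi `^ p + 2 `^ p)].
Proof.
move=> p1 L0; pose q := p^-1.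
have p0 : 0 < p by exact: lt_trans p1.
have q01 : 0 < q < 1 by rewrite invr_gt0 p0 invf_lt1.
have /andP[q0 q1] := q01.
have qp : q * p = 1 by rewrite mulVf// gt_eqF.
have [v [d H]] := riesz_products q01 L0.
pose a := 1 - q * (1 - q) / 64.
have a01 : 0 <= a < 1 by rewrite /a; apply/andP; split; nra.
have a10 : 0 < 1 - a by case/andP: a01; rewrite subr_gt0.
pose u k t := v k t `^ q.
have cv k : continuous (v k) by have [[/C1_bounded_continuous]] := H k.
have cu k : continuous (u k) by have [[_ /C1_bounded_continuous]] := H k.
have u0 k t : 0 <= u k t by exact: powR_ge0.
have vgt0 k t : 0 < v k t by have [_ [[m m0 mv] _] _ _ _] := H k; exact: lt_le_trans (mv t).
have up k t : u k t `^ p = v k t by rewrite /u -powRrM qp powRr1// ltW.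
have iv k := continuous_loc_integrable (cv k).
have iu k := continuous_loc_integrable (cu k).
have d_mono i k : (i <= k)%N -> d k <= d i.
  elim: k => [|k IH]; first by rewrite leqn0 => /eqP ->.
  rewrite leq_eqVlt => /predU1P[->//|/IH]; apply: le_trans.
  by have [_ _ [_ _ ? _] _ _] := H k.
have lvl l : 0 < l -> exists j, d j.+1 <= l /\ forall k, (k < j)%N -> l <= d k.+1.
  by move=> l0; apply: scale_level => // k; have [_ _ [_ _ _ ?] _ _] := H k.
have uS j c l : d j.+1 <= l -> forall k, (j <= k)%N ->
    mean c l (u k.+1) <= a * mean c l (u k) + 2^-1 ^+ k.+1.
  move=> dl k jk; have [_ _ _ _ /(_ c l)] := H k.
  by move=> [|_]//; apply: le_trans dl; exact: d_mono.
(* Telescoping: the errors 2^-(k+2) add up to at most 1/2. *)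
have vS j J c l : d j.+1 <= l -> (j <= J)%N ->
    `|mean c l (v J) - mean c l (v j)| <= 2^-1.
  move=> dl jJ; rewrite -(telescope_sumr (fun k => mean c l (v k)) jJ) (le_trans (ler_norm_sum _ _ _))//.
  apply: (@le_trans _ _ (\sum_(j <= k < J) 2^-1 ^+ k.+2)).
    apply: ler_sum_nat => k /andP[jk _]; have [_ _ _ _ /(_ c l)] := H k.
    by move=> [|//]; apply: le_trans dl; exact: d_mono.
  apply: (@le_trans _ _ (\sum_(0 <= k < J) 2^-1 ^+ k.+2)).
    by rewrite [leRHS](big_cat_nat (leq0n j) jJ)/= lerDr sumr_ge0// => k _; exact: exprn_ge0.
  rewrite big_mkord; under eq_bigr do rewrite !exprS mulrA.
  rewrite -mulr_sumr; apply: (@le_trans _ _ (2^-1 / 2 * 2)); last by lra.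
  by rewrite ler_pM2l ?divr_gt0 ?invr_gt0//; exact: geometric_half_le.
pose phi := series_fun u.
have dist c l j : 0 < l -> d j.+1 <= l -> (forall k, (k < j)%N -> l <= d k.+1) ->
   (\int[lebesgue_measure]_(t in `[c, (c + l)%R]) `|phi t - \sum_(k < j) u k c|%:E <=
   (l * (2 + (mean c l (u j) + 1) / (1 - a)))%:E)%E.
  move=> l0 dl ld; apply: (@integral_series_dist_le _ u a j (fun k => u k c)) => //; first exact: uS dl.
  move=> k t /andP[ct tcl] kj; have [_ _ _ + _] := H k; apply.
  by apply: le_trans (ld _ kj); rewrite ger0_norm ?subr_ge0// lerBlDl.
have mphi : measurable_fun setT phi by exact: measurable_series_fun.
have iphi : loc_integrable phi.
  apply: loc_integrable_gt0 => c l l0; have [j [dl ld]] := lvl l l0.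
  have : lebesgue_measure.-integrable `[c, (c + l)%R]
      (EFin \o (fun t => phi t - \sum_(k < j) u k c)).
    apply/integrableP; split.
      by apply/measurable_EFinP; apply: measurable_funTS; exact: measurable_funB.
    by apply: le_lt_trans (dist c l j l0 dl ld) _; exact: ltry.
  move=> /integrableD /(_ (@cst_loc_integrable _ (\sum_(k < j) u k c) c l)).
  move=> /(_ (measurable_itv _)); congr (integrable _ _ _).
  by apply/funext => t /=; rewrite -EFinD subrK.
have iphin r : loc_integrable (fun t => `|phi t - r|).
  by apply: loc_integrable_norm; apply: loc_integrableB => //; exact: cst_loc_integrable.
pose K := 2 * (2 + (1 - a)^-1).
have K0 : 0 <= K by rewrite mulr_ge0// addr_ge0// invr_ge0 ltW.
exists phi, v, (K `^ p * 2 `^ p * 2); split.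
- by split => // t; exact: series_fun_ge0.
- split => // [|k t]; last exact: ltW.
  by rewrite !mulr_ge0// powR_ge0.
- move=> c l l0; have [j [dl ld]] := lvl l l0; exists j => J jJ.
  set X := mean c l (u j); have X0 : 0 <= X by exact: mean_ge0.
  have osc : mean c l (fun t => `|phi t - mean c l phi|) <= K * (1 + X).
    apply: (le_trans (mean_oscillation_le c (\sum_(k < j) u k c) l0 iphi)).
    have := dist c l j l0 dl ld; rewrite mean_EFin// lee_fin ler_pM2l// -/X => h.
    apply: (@le_trans _ _ (2 * (2 + (X + 1) / (1 - a)))); first by rewrite ler_pM2l.
    rewrite /K; lra.
  have oscp : mean c l (fun t => `|phi t - mean c l phi|) `^ p <=
      K `^ p * 2 `^ p * (1 + X `^ p).
    apply: (@le_trans _ _ ((K * (1 + X)) `^ p)).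
      apply: ge0_ler_powR => //; rewrite ?nnegrE ?(ltW p0)//; first exact: mean_ge0.
      by rewrite mulr_ge0// addr_ge0.
    rewrite powRM ?addr_ge0// -mulrA ler_wpM2l ?powR_ge0//.
    by have := powR_add_le (ltW p0) ler01 X0; rewrite powR1.
  apply: (le_trans oscp).
  rewrite -[leRHS]mulrA ler_wpM2l ?mulr_ge0 ?powR_ge0//.
  (* Since u_j = v_j^q and q p = 1, Jensen passes from the mean of u_j to that of v_j. *)
  have Xp : X `^ p <= mean c l (v j).
    have M0 : 0 <= mean c l (v j) by apply: mean_ge0 => // t; exact: ltW.
    rewrite -[leRHS](powRr1 M0) -qp powRrM.
    apply: ge0_ler_powR; rewrite ?nnegrE ?powR_ge0 ?(ltW p0)//.
    apply: mean_jensen => //; first exact: cu.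
    by have [_ [? _] _ _ _] := H j.
  have MJ0 : 0 <= mean c l (v J) by apply: mean_ge0 => // t; exact: ltW.
  have := vS j J c l dl jJ; rewrite ler_norml => /andP[h1 h2]; lra.
- move=> c l k Ll; have l0 : 0 < l by exact: lt_le_trans Ll.
  have d1 : d 1%N <= l.
    by have [_ _ [_ + + _] _ _] := H 0%N => h1 h2; rewrite (le_trans h2)// (le_trans h1).
  have := vS 0%N k c l d1 (leq0n _).
  have -> : mean c l (v 0%N) = 1 by have [_ [_ ->] _ _ _] := H 0%N; rewrite mean_cst.
  by rewrite ler_norml => /andP[h1 h2]; apply/andP; split; lra.
- move=> J; exists (d J); first by have [_ _ [? _ _ _] _ _] := H J.
  move=> c l /andP[l0 ldJ].
  have iF : loc_integrable (fun t => \sum_(k < J) u k t) by exact: loc_integrable_sum.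
  have iU : lebesgue_measure.-integrable `[c, (c + l)%R] (fun t => (\sum_(k <oo) (u k t)%:E)%E).
    have [j [dl _]] := lvl l l0.
    exact: integrable_series_fun a01 l0 cu u0 (uS j c l dl).
  have Fphi := mean_partial_sum_le J l0 cu u0 iU iphi.
  have phi0 : 0 <= mean c l phi by apply: mean_ge0 => // t; exact: series_fun_ge0.
  (* On an interval of length at most d_J each u_k with k < J varies by at most 2^-k, so the partial
     sum exceeds its mean by at most 2. *)
  have Ft t : c <= t <= c + l -> \sum_(k < J) u k t <= mean c l phi + 2.
    move=> /andP[ct tc]; rewrite -lerBlDr; apply: le_trans Fphi.
    rewrite -[leLHS](mean_cst c _ l0); apply: le_mean => //; first exact: cst_loc_integrable.
    move=> s /andP[cs sc]; rewrite lerBlDr -lerBlDl -sumrB.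
    apply: (le_trans _ (geometric_half_le J)); apply: ler_sum => k _.
    apply: (le_trans (ler_norm _)); have [_ _ _ + _] := H k; apply.
    apply: (@le_trans _ _ l); first by rewrite ler_norml; apply/andP; split; lra.
    by apply: (le_trans ldJ); exact: d_mono.
  rewrite -mean_sum//.
  rewrite -[leRHS](mean_cst c _ l0); apply: le_mean => //.
  + exact: loc_integrable_sum.
  + exact: cst_loc_integrable.
  move=> t tc; under eq_bigr do rewrite -up.
  apply: (le_trans (powR_superadd_sum _ (ltW p1) (fun k : 'I_J => u0 k t))).
  apply: (@le_trans _ _ ((mean c l phi + 2) `^ p)).
    apply: ge0_ler_powR; rewrite ?nnegrE ?addr_ge0 ?sumr_ge0 ?(ltW p0)//.
    exact: Ft.
  by apply: powR_add_le => //; exact: ltW.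
Qed.

End one_dimensional_example.

(** * Averages over cubes *)

Section cubes_and_averages.
Context {R : realType} {n : nat}.
Implicit Types (Q S : set 'rV[R]_n.+1) (a : 'rV[R]_n.+1) (p l : R).
Let X := caratheodory_type (@lebesgue_outer R n).
Let mu : {measure set X -> \bar R} := @lebesgue_meas R n.

Definition cube a l (lo hi : 'I_n.+1 -> bool) : set 'rV[R]_n.+1 :=
  rect a (\row_i (a ord0 i + l)) lo hi.

Lemma is_cubeP S : is_cube S <-> exists a l lo hi, 0 < l /\ S = cube a l lo hi.
Proof.
split=> -[a [l [lo [hi [l0 ->]]]]]; exists a, l, lo, hi; split => //;
  by apply/seteqP; split => x xS i; have := xS i; rewrite mxE.
Qed.

Lemma lebesgue_meas_cube a l lo hi : 0 < l -> mu (cube a l lo hi) = (l ^+ n.+1)%:E.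
Proof.
move=> l0; rewrite [LHS]lebesgue_meas_rect; last by move=> i; rewrite mxE ltrDl.
congr EFin; rewrite -[X in _ ^+ X]card_ord -prodr_const; apply: eq_bigr => i _.
by rewrite mxE addrAC subrr add0r.
Qed.

Lemma volume_cube a l lo hi : 0 < l -> volume (cube a l lo hi) = l ^+ n.+1.
Proof. by move=> l0; rewrite /volume [lebesgue_meas _](lebesgue_meas_cube _ _ _ l0). Qed.

Lemma volume_ge0 S : 0 <= volume S.
Proof. by rewrite fine_ge0// (measure_ge0 mu). Qed.

Lemma volume_gt0 S : is_cube S -> 0 < volume S.
Proof. by move/is_cubeP => [a [l [lo [hi [l0 ->]]]]]; rewrite volume_cube// exprn_gt0. Qed.

Lemma measurable_cube S : is_cube S -> measurable (S : set X).
Proof. by move/is_cubeP => [a [l [lo [hi [l0 ->]]]]]; exact: measurable_rect. Qed.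

Lemma lebesgue_meas_is_cube S : is_cube S -> mu S = (volume S)%:E.
Proof.
move/is_cubeP => [a [l [lo [hi [l0 ->]]]]].
by rewrite volume_cube// lebesgue_meas_cube.
Qed.

Lemma integral_cube a l lo hi (h : R -> R) : 0 < l -> measurable_fun setT h ->
  (forall t, 0 <= h t) -> loc_integrable h ->
  (\int[mu]_(x in cube a l lo hi) (h (x ord0 ord0))%:E =
   (l ^+ n.+1 * mean (a ord0 ord0) l h)%:E)%E.
Proof.
move=> l0 mh h0 ih.
rewrite [LHS](@ge0_integral_rect R n a _ lo hi (EFin \o h)); last 3 first.
- by move=> i; rewrite mxE ltrDl.
- exact/measurable_EFinP.
- by move=> t; rewrite lee_fin h0.
rewrite mxE mean_EFin//= -EFinM exprSr -mulrA; congr (_ * _)%:E.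
rewrite -[X in _ ^+ X](card_ord n) -prodr_const.
rewrite [RHS](_ : _ = \prod_(i < n.+1 | i != ord0) l).
  by apply: eq_bigr => i _; rewrite mxE addrAC subrr add0r.
by rewrite !prodr_const cardC1 !card_ord.
Qed.

Lemma avg_cube a l lo hi (h : R -> R) : 0 < l -> measurable_fun setT h ->
  (forall t, 0 <= h t) -> loc_integrable h ->
  avg (cube a l lo hi) (fun x => h (x ord0 ord0)) = mean (a ord0 ord0) l h.
Proof.
move=> l0 mh h0 ih; rewrite /avg volume_cube// /Rintegral.
rewrite [X in fine X](integral_cube a lo hi l0 mh h0 ih) /= mulrA mulVf ?mul1r//.
by rewrite gt_eqF// exprn_gt0.
Qed.

Lemma measurable_comp_coordinate (h : R -> R) : measurable_fun setT h ->
  measurable_fun (setT : set X) (fun x => h ((x : 'rV[R]_n.+1) ord0 ord0)).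
Proof. by move=> mh; exact: measurableT_comp mh (measurable_coordinate ord0). Qed.

Lemma L1_comp_coordinate Q (h : R -> R) : is_cube Q -> measurable_fun setT h ->
  (forall t, 0 <= h t) -> loc_integrable h -> L1 Q (fun x => h (x ord0 ord0)).
Proof.
move=> /is_cubeP[a [l [lo [hi [l0 ->]]]]] mh h0 ih; apply/integrableP; split.
  by apply/measurable_EFinP; apply: measurable_funTS; exact: measurable_comp_coordinate.
under eq_integral => x _ do rewrite /= ger0_norm//.
by rewrite [X in (X < _)%E](integral_cube a lo hi l0 mh h0 ih) ltry.
Qed.

(** The sum over a collection is the supremum of its finite subsums, and subcollections are again
    collections; so finite families, given as duplicate-free lists, decide finiteness. *)
Lemma cube_norm_ltP p Q (F : set 'rV[R]_n.+1 -> R) : 0 < p ->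
  (cube_norm p Q F < +oo)%E <->
  exists M, forall s, uniq s -> cube_collection Q [set` s] ->
    \sum_(S <- s) volume S * F S `^ p <= M.
Proof.
move=> p0; have pi0 : p^-1 != 0 by rewrite invr_eq0 gt_eqF.
have G0 S : (0 <= (volume S * F S `^ p)%:E)%E.
  by rewrite lee_fin mulr_ge0 ?volume_ge0 ?powR_ge0.
split=> [/(lty_poweRy pi0)|[M HM]].
  set E := [set _ | _ in _] => supE.
  have sup0 : (0 <= ereal_sup E)%E.
    apply: ereal_sup_ubound; exists set0; last exact: esum_set0.
    by split => // ? ? [].
  exists (fine (ereal_sup E)) => s us cs.
  rewrite -lee_fin fineK; last by rewrite ge0_fin_numE.
  apply: ereal_sup_ubound; exists [set` s] => //.
  by rewrite esum_fset//; [rewrite -fsbig_seq// sumEFin|exact: finite_seq].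
apply: poweR_lty; apply: (@le_lt_trans _ _ M%:E); last exact: ltry.
apply: ge_ereal_sup => _ [C [Cc CQ CI] <-]; apply: ge_ereal_sup => _ [A [finA AC] <-].
rewrite fsbig_finite//= sumEFin lee_fin; apply: HM; first exact: fset_uniq.
have AE S : [set` enum_fset (fset_set A)] S -> A S.
  by move=> SA; rewrite -(fset_setK finA).
split => [S /AE /AC /Cc|S /AE /AC /CQ|]//.
by apply: sub_trivIset CI => S /AE /AC.
Qed.

Lemma cube_norm_dominated p Q (F G : set 'rV[R]_n.+1 -> R) (K : R) : 0 < p -> 0 <= K ->
  (forall S, is_cube S -> S `<=` Q -> 0 <= F S <= K * G S) ->
  (forall S, 0 <= G S) ->
  (cube_norm p Q G < +oo)%E -> (cube_norm p Q F < +oo)%E.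
Proof.
move=> p0 K0 FG G0 /(cube_norm_ltP _ _ p0)[M HM]; apply/(cube_norm_ltP _ _ p0).
exists (K `^ p * M) => s us cs; apply: (@le_trans _ _ (\sum_(S <- s) K `^ p * (volume S * G S `^ p))).
  rewrite big_seq [leRHS]big_seq; apply: ler_sum => S Ss.
  have [Cs CQ _] := cs; have /andP[F0 FKG] := FG S (Cs _ Ss) (CQ _ Ss).
  rewrite mulrCA ler_wpM2l ?volume_ge0// -powRM//.
  by apply: ge0_ler_powR; rewrite ?nnegrE ?mulr_ge0// ltW.
by rewrite -mulr_sumr ler_wpM2l ?powR_ge0// HM.
Qed.

End cubes_and_averages.

(** * Cube-by-cube comparison of the three functionals *)

Section averages_over_cubes.
Context {R : realType} {n : nat}.
Implicit Types (Q S : set 'rV[R]_n.+1) (f g : 'rV[R]_n.+1 -> R) (p r : R).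
Let X := caratheodory_type (@lebesgue_outer R n).
Let mu : {measure set X -> \bar R} := @lebesgue_meas R n.

Lemma cst_integrable_cube S r : is_cube S -> mu.-integrable S (EFin \o (fun=> r)).
Proof.
move=> cS; apply/integrableP; split; first exact: measurable_cst.
rewrite integral_cst; last exact: measurable_cube.
by rewrite [mu S](lebesgue_meas_is_cube cS) -EFinM ltry.
Qed.

Lemma L1_subcube Q S f : is_cube Q -> is_cube S -> S `<=` Q -> L1 Q f ->
  mu.-integrable S (EFin \o f).
Proof. by move=> cQ cS SQ; apply: integrableS => //; exact: measurable_cube. Qed.

Lemma avgD S f g : is_cube S ->
  mu.-integrable S (EFin \o f) -> mu.-integrable S (EFin \o g) ->
  avg S (fun x => f x + g x) = avg S f + avg S g.
Proof.
move=> cS fi gi; rewrite /avg -mulrDr; congr (_ * _).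
by apply: (@RintegralD _ _ _ mu) => //; exact: measurable_cube.
Qed.

Lemma avg_cst S r : is_cube S -> avg S (fun=> r) = r.
Proof.
move=> cS; rewrite /avg [X in _ * X](@Rintegral_cst _ _ _ mu); last exact: measurable_cube.
by rewrite [fine _]/(volume S) mulrCA mulVf ?mulr1// gt_eqF// volume_gt0.
Qed.

Lemma le_avg S f g : is_cube S ->
  mu.-integrable S (EFin \o f) -> mu.-integrable S (EFin \o g) ->
  (forall x, f x <= g x) -> avg S f <= avg S g.
Proof.
move=> cS fi gi fg; rewrite /avg ler_pM2l ?invr_gt0 ?volume_gt0//.
by apply: (@le_Rintegral _ _ _ mu) => //; exact: measurable_cube.
Qed.

Lemma avg_norm_ge0 S f : 0 <= avg S (fun x => `|f x|).
Proof. by rewrite mulr_ge0 ?invr_ge0 ?volume_ge0//; exact: Rintegral_ge0. Qed.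

Lemma norm_avg_le S f : is_cube S -> mu.-integrable S (EFin \o f) ->
  `|avg S f| <= avg S (fun x => `|f x|).
Proof.
move=> cS fi; rewrite /avg normrM gtr0_norm ?invr_gt0 ?volume_gt0//.
rewrite ler_pM2l ?invr_gt0 ?volume_gt0//.
by apply: (@le_normr_Rintegral _ _ _ mu) => //; exact: measurable_cube.
Qed.

Lemma integrable_subr_cube S f r : is_cube S -> mu.-integrable S (EFin \o f) ->
  mu.-integrable S (EFin \o (fun x => f x - r)).
Proof.
move=> cS fi; rewrite (_ : EFin \o _ = ((EFin \o f) \- (EFin \o (fun=> r)))%E)//.
by apply: integrableB => //; [exact: measurable_cube|exact: cst_integrable_cube].
Qed.

Lemma avg_norm_subr_le S f r : is_cube S -> mu.-integrable S (EFin \o f) ->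
  avg S (fun x => `|f x - r|) <= avg S (fun x => `|f x|) + `|r|.
Proof.
move=> cS fi; have ni := integrable_norm fi.
rewrite -[X in _ + X](avg_cst `|r| cS) -avgD//; last exact: cst_integrable_cube.
apply: le_avg => //.
- exact/integrable_norm/integrable_subr_cube.
- pose f1 (x : 'rV[R]_n.+1) := `|f x|; pose f2 (x : 'rV[R]_n.+1) := `|r|.
  rewrite (_ : EFin \o _ = ((EFin \o f1) \+ (EFin \o f2))%E)//.
  by apply: integrableD => //; [exact: measurable_cube|exact: cst_integrable_cube].
- by move=> x; exact: ler_normB.
Qed.

Lemma avg_oscillation_le S f r : is_cube S -> mu.-integrable S (EFin \o f) ->
  avg S (fun x => `|f x - avg S f|) <= 2 * avg S (fun x => `|f x - r|).
Proof.
move=> cS fi; have fri := integrable_subr_cube r cS fi.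
have avgr : avg S (fun x => f x - r) = avg S f - r.
  rewrite (_ : (fun x => f x - r) = (fun x => f x + (fun=> - r) x))//.
  by rewrite avgD ?avg_cst//; exact: cst_integrable_cube.
have := avg_norm_subr_le (avg S f - r) cS fri.
rewrite (_ : (fun x => _) = (fun x => `|f x - avg S f|)); last first.
  by apply/funext => x; congr `|_|; lra.
have := norm_avg_le cS fri; rewrite avgr; lra.
Qed.

Lemma RM_sub_JNt p Q : 0 < p -> is_cube Q -> RM p Q `<=` JNt p Q.
Proof.
move=> p0 cQ f [fL fRM]; split; first exact: fL.
apply: (cube_norm_dominated p0 (ler0n R 2) _ _ fRM) => S; last exact: avg_norm_ge0.
move=> cS SQ; apply/andP; split; first exact: avg_norm_ge0.
have := avg_norm_subr_le (avg S (fun y => `|f y|)) cS (L1_subcube cQ cS SQ fL).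
by rewrite (ger0_norm (avg_norm_ge0 _ _)) mulr_natl mulr2n.
Qed.

(** |f|_S is one particular constant, and the oscillation about f_S is at most twice that about any
    constant. *)
Lemma JNt_sub_JN p Q : 0 < p -> is_cube Q -> JNt p Q `<=` JN p Q.
Proof.
move=> p0 cQ f [fL fJ]; split; first exact: fL.
apply: (cube_norm_dominated p0 (ler0n R 2) _ _ fJ) => S; last exact: avg_norm_ge0.
move=> cS SQ; apply/andP; split; first exact: avg_norm_ge0.
exact: avg_oscillation_le cS (L1_subcube cQ cS SQ fL).
Qed.

Lemma integrable_oppr_cube S f : is_cube S -> mu.-integrable S (EFin \o f) ->
  mu.-integrable S (EFin \o (fun x => - f x)).
Proof.
move=> cS fi; have -> : EFin \o (fun x => - f x) = (\- (EFin \o f))%E by apply/funext.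
by apply: integrableN => //; exact: measurable_cube.
Qed.

Lemma avgN S f : is_cube S -> mu.-integrable S (EFin \o f) ->
  avg S (fun x => - f x) = - avg S f.
Proof.
move=> cS fi; have := avgD cS (integrable_oppr_cube cS fi) fi.
under eq_fun do rewrite addNr.
by rewrite (avg_cst 0 cS) => /esym/eqP; rewrite addr_eq0 => /eqP.
Qed.

Lemma avg_oppr_oscillation S f : is_cube S -> mu.-integrable S (EFin \o f) ->
  avg S (fun x => `|- f x - avg S (fun y => - f y)|) = avg S (fun x => `|f x - avg S f|).
Proof.
move=> cS fi; rewrite (avgN cS fi); congr (avg _ _).
by apply/funext => x; rewrite -opprD normrN.
Qed.

(* If f >= 0 then |-f| has average f_S, hence |-f - |-f|_S| has average 2 f_S. *)
Lemma avg_le_oppr_oscillation S f : is_cube S -> mu.-integrable S (EFin \o f) ->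
  (forall x, 0 <= f x) ->
  avg S (fun x => `|f x|) <= avg S (fun x => `|- f x - avg S (fun y => `|- f y|)|).
Proof.
move=> cS fi f0; have fN : (fun x => `|f x|) = f by apply/funext => x; rewrite ger0_norm.
have -> : (fun x => `|- f x|) = f by apply/funext => x; rewrite normrN ger0_norm.
have A0 : 0 <= avg S f by rewrite -fN avg_norm_ge0.
rewrite fN; apply: le_avg => //.
- exact/integrable_norm/integrable_subr_cube/integrable_oppr_cube.
- by move=> x; rewrite -opprD normrN ger0_norm ?addr_ge0// lerDl.
Qed.

Lemma JN_oppr p Q f : 0 < p -> is_cube Q -> JN p Q f -> JN p Q (fun x => - f x).
Proof.
move=> p0 cQ [fL fJ]; split; first exact: integrable_oppr_cube cQ fL.
apply: (cube_norm_dominated p0 (ler0n R 1) _ _ fJ) => S; last exact: avg_norm_ge0.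
move=> cS SQ; apply/andP; split; first exact: avg_norm_ge0.
by rewrite mul1r (avg_oppr_oscillation cS (L1_subcube cQ cS SQ fL)).
Qed.

Lemma JNt_oppr_RM p Q f : 0 < p -> is_cube Q -> (forall x, 0 <= f x) -> L1 Q f ->
  JNt p Q (fun x => - f x) -> RM p Q f.
Proof.
move=> p0 cQ f0 fL [_ fJ]; split; first exact: fL.
apply: (cube_norm_dominated p0 (ler0n R 1) _ _ fJ) => S; last exact: avg_norm_ge0.
move=> cS SQ; apply/andP; split; first exact: avg_norm_ge0.
rewrite mul1r; exact: avg_le_oppr_oscillation cS (L1_subcube cQ cS SQ fL) f0.
Qed.

End averages_over_cubes.

(** * Families of disjoint cubes *)

Section cube_families.
Context {R : realType} {n : nat}.
Implicit Types (Q S : set 'rV[R]_n.+1) (a : 'rV[R]_n.+1) (p l : R) (h : R -> R).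
Let X := caratheodory_type (@lebesgue_outer R n).
Let mu : {measure set X -> \bar R} := @lebesgue_meas R n.

Definition integrand h := [/\ measurable_fun setT h, forall t, 0 <= h t & loc_integrable h].

Lemma integral_is_cube S h : is_cube S -> integrand h ->
  (\int[mu]_(x in S) (h (x ord0 ord0))%:E =
   (volume S * avg S (fun x => h (x ord0 ord0)))%:E)%E.
Proof.
move=> /is_cubeP[a [l [lo [hi [l0 ->]]]]] [mh h0 ih].
by rewrite volume_cube// avg_cube// integral_cube.
Qed.

Lemma open_cube_sub_interior a l lo hi :
  cube a l (fun=> false) (fun=> true) `<=` (cube a l lo hi)°.
Proof.
move=> x xC.
have : nbhs x (fun y : 'rV[R]_n.+1 => forall i : 'I_n.+1, y ord0 i \in `]a ord0 i, a ord0 i + l[).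
  apply: (@filter_forall _ _ (fun i (y : 'rV[R]_n.+1) => y ord0 i \in `]a ord0 i, a ord0 i + l[)
    (nbhs x) (nbhs_filter x)) => i.
  apply: (@coord_continuous R 1 n.+1 ord0 i x [set` `]a ord0 i, a ord0 i + l[]).
  apply: open_nbhs_nbhs; split; first exact: interval_open.
  by have := xC i; rewrite mxE.
rewrite /interior; apply: filterS => y yC i; rewrite mxE.
have := yC i; rewrite !in_itv/= => /andP[ay ya].
by apply/andP; split; [case: (lo i)|case: (hi i)] => //=; rewrite ltW.
Qed.

Lemma sum_disjoint_cubes_le Q (s : seq (set 'rV[R]_n.+1)) h : is_cube Q -> uniq s ->
  cube_collection Q [set` s] -> integrand h ->
  \sum_(S <- s) volume S * avg S (fun x => h (x ord0 ord0)) <=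
  volume Q * avg Q (fun x => h (x ord0 ord0)).
Proof.
move=> cQ us [Cs CQ Ci] sh; have [mh h0 ih] := sh.
(* The cubes overlap on null sets: replace each one by its open interior.     *)
have coreP S : exists O : set X, [/\ measurable O, O `<=` S° &
    is_cube S -> (\int[mu]_(x in O) (h ((x : 'rV[R]_n.+1) ord0 ord0))%:E =
                  \int[mu]_(x in S) (h ((x : 'rV[R]_n.+1) ord0 ord0))%:E)%E].
  (* Sets that are not cubes get the empty core, so that a core can be chosen for every set. *)
  have [cS|ncS] := pselect (is_cube S); last by exists set0; split => // x [].
  have [a [l [lo [hi [l0 SE]]]]] := (is_cubeP S).1 cS.
  exists (cube a l (fun=> false) (fun=> true)); split; first exact: measurable_rect.
    by rewrite SE; exact: open_cube_sub_interior.
  by move=> _; rewrite SE !integral_cube.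
have [core coreE] := choice coreP.
have mO S : measurable (core S) by have [] := coreE S.
have mhX := measurable_comp_coordinate (n := n) mh.
rewrite -lee_fin -sumEFin -integral_is_cube//.
rewrite big_seq.
rewrite (eq_bigr (fun S => \int[mu]_(x in core S) (h ((x : 'rV[R]_n.+1) ord0 ord0))%:E)%E); last first.
  move=> S Ss; have [_ _ ->] := coreE S; last exact: Cs.
  by rewrite integral_is_cube//; exact: Cs.
rewrite -big_seq -(@ge0_integral_bigsetU _ _ _ mu _ core (fun x : X => (h ((x : 'rV[R]_n.+1) ord0 ord0))%:E))//.
- apply: ge0_subset_integral => //.
  + exact: bigsetU_measurable.
  + exact: measurable_cube.
  + by apply/measurable_EFinP; exact: measurable_funTS.
  + by move=> x _; rewrite lee_fin.
  + rewrite -bigcup_seq => x [S /= Ss OSx]; apply: (CQ S Ss).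
    by apply: interior_subset; have [_ + _] := coreE S; apply.
- move=> S S' Ss Ss' [x [OSx OS'x]]; apply: Ci => //; exists x.
  by split; [have [_ + _] := coreE S|have [_ + _] := coreE S']; apply.
- by apply/measurable_EFinP; exact: measurable_funTS.
- by move=> x _; rewrite lee_fin.
Qed.

(** The maximum of finitely many thresholds; this is where working with finite families pays off. *)
Lemma eventually_all (T : eqType) (s : seq T) (P : T -> nat -> Prop) :
  (forall x, x \in s -> exists j, forall J, (j <= J)%N -> P x J) ->
  exists J, forall x, x \in s -> P x J.
Proof.
move=> H; suff [j Hj] : exists j, forall x J, x \in s -> (j <= J)%N -> P x J.
  by exists j => x xs; exact: Hj.
elim: s H => [_|y s IH H]; first by exists 0%N.
have [j Hj] := IH (fun x xs => H x (mem_behead (s := y :: s) xs)).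
have [i Hi] := H y (mem_head y s).
exists (maxn i j) => x J; rewrite in_cons geq_max => /orP[/eqP ->|xs] /andP[iJ jJ].
  exact: Hi.
exact: Hj.
Qed.

(** Half-open cells partition the half-open cube exactly, so grid sums are equalities without null
    sets. *)
Definition grid_cube a l m (k : {ffun 'I_n.+1 -> 'I_m}) : set 'rV[R]_n.+1 :=
  cube (\row_i (a ord0 i + l / m%:R * (k i)%:R)) (l / m%:R) (fun=> false) (fun=> false).

Definition grid a l m : seq (set 'rV[R]_n.+1) :=
  [seq grid_cube a l k | k <- enum {ffun 'I_n.+1 -> 'I_m}].

Lemma is_cube_grid a l m (k : {ffun 'I_n.+1 -> 'I_m}) : 0 < l -> (0 < m)%N ->
  is_cube (grid_cube a l k).
Proof.
move=> l0 m0; apply/is_cubeP; do 4!eexists; split; last by reflexivity.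
by rewrite divr_gt0// ltr0n.
Qed.

Lemma mem_grid_cube a l m (k : {ffun 'I_n.+1 -> 'I_m}) x : grid_cube a l k x <->
  forall i, l / m%:R * (k i)%:R < x ord0 i - a ord0 i <= l / m%:R * (k i).+1%:R.
Proof.
split=> h i; have := h i; rewrite !mxE in_itv/= -natr1 mulrDr mulr1;
  by move=> /andP[h1 h2]; apply/andP; split; lra.
Qed.

Lemma grid_cube_disjoint a l m (k k' : {ffun 'I_n.+1 -> 'I_m}) x :
  0 < l -> (0 < m)%N -> grid_cube a l k x -> grid_cube a l k' x -> k = k'.
Proof.
move=> l0 m0 /mem_grid_cube h /mem_grid_cube h'; apply/ffunP => i; apply/val_inj/eqP => /=.
have e0 : 0 < l / m%:R by rewrite divr_gt0// ltr0n.
have /andP[h1 h2] := h i; have /andP[h1' h2'] := h' i.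
have := lt_le_trans h1 h2'; have := lt_le_trans h1' h2.
by rewrite !ltr_pM2l// !ltr_nat !ltnS eqn_leq => -> ->.
Qed.

Lemma grid_uniq a l m : 0 < l -> (0 < m)%N -> uniq (grid a l m).
Proof.
move=> l0 m0; rewrite map_inj_uniq ?enum_uniq// => k k' kk'.
(* The far corner belongs to its own cell and determines the index. *)
pose x : 'rV[R]_n.+1 := \row_i (a ord0 i + l / m%:R * (k i).+1%:R).
have kx : grid_cube a l k x.
  apply/mem_grid_cube => i; rewrite mxE addrAC subrr add0r lexx andbT.
  by rewrite ltr_pM2l ?ltr_nat// divr_gt0// ltr0n.
by apply: (grid_cube_disjoint l0 m0 kx); rewrite -kk'.
Qed.

Lemma bigcup_grid a l m : 0 < l -> (0 < m)%N ->
  \big[setU/set0]_(k <- enum {ffun 'I_n.+1 -> 'I_m}) grid_cube a l k =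
  cube a l (fun=> false) (fun=> false).
Proof.
move=> l0 m0; have e0 : 0 < l / m%:R by rewrite divr_gt0// ltr0n.
have lE : l / m%:R * m%:R = l by rewrite divfK// gt_eqF// ltr0n.
rewrite -bigcup_seq; apply/seteqP; split=> [x [k _ /mem_grid_cube xk] i|x xC].
  have /andP[h1 h2] := xk i; rewrite mxE in_itv/=.
  have : 0 <= l / m%:R * (k i)%:R by rewrite mulr_ge0// ltW.
  have : l / m%:R * (k i).+1%:R <= l by rewrite -[leRHS]lE ler_pM2l// ler_nat.
  by move=> ? ?; apply/andP; split; lra.
have ex i : exists j : 'I_m, l / m%:R * j%:R < x ord0 i - a ord0 i <= l / m%:R * j.+1%:R.
  have := xC i; rewrite mxE in_itv/= => /andP[ax xa].
  have exj : exists j, x ord0 i - a ord0 i <= l / m%:R * j.+1%:R.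
    by exists m.-1; rewrite prednK// lE; lra.
  (* Minimality of [j] gives the strict lower bound; for j = 0 it is the openness of the cube at its
     left face. *)
  case: (ex_minnP exj) => j xj jmin.
  have jm : (j < m)%N by rewrite -(prednK m0) ltnS; apply: jmin; rewrite prednK// lE; lra.
  exists (Ordinal jm) => /=; rewrite xj andbT.
  case: j jmin {xj jm} => [_|j jmin]; first by rewrite mulr0; lra.
  by rewrite ltNge; apply/negP => /jmin; rewrite ltnn.
have [k kP] := choice ex.
exists [ffun i => k i]; first by rewrite /= mem_enum.
by apply/mem_grid_cube => i; rewrite ffunE; exact: kP.
Qed.

Lemma sum_grid a l m h : 0 < l -> (0 < m)%N -> integrand h ->
  \sum_(S <- grid a l m) volume S * avg S (fun x => h (x ord0 ord0)) =
  volume (cube a l (fun=> false) (fun=> false)) *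
  avg (cube a l (fun=> false) (fun=> false)) (fun x => h (x ord0 ord0)).
Proof.
move=> l0 m0 sh; have [mh h0 ih] := sh.
have cC : is_cube (cube a l (fun=> false) (fun=> false)).
  by apply/is_cubeP; do 4!eexists; split; [exact: l0|reflexivity].
have mhX := measurable_comp_coordinate (n := n) mh.
rewrite big_map; apply: EFin_inj; rewrite -sumEFin -integral_is_cube//.
under eq_bigr do rewrite -(integral_is_cube (is_cube_grid _ _ l0 m0) sh).
rewrite -(bigcup_grid a l0 m0).
rewrite (@ge0_integral_bigsetU _ _ _ mu _ (@grid_cube a l m) (fun x : X => (h ((x : 'rV[R]_n.+1) ord0 ord0))%:E))//.
- by move=> k; exact/measurable_cube/is_cube_grid.
- exact: enum_uniq.
- by move=> k k' _ _ [x [kx k'x]]; exact: grid_cube_disjoint l0 m0 kx k'x.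
- by apply/measurable_EFinP; exact: measurable_funTS.
- by move=> x _; rewrite lee_fin.
Qed.

Lemma grid_collection a l m Q : 0 < l -> (0 < m)%N ->
  cube a l (fun=> false) (fun=> false) `<=` Q -> cube_collection Q [set` grid a l m].
Proof.
move=> l0 m0 CQ; split.
- by move=> S /mapP[k _ ->]; exact: is_cube_grid.
- move=> S /mapP[k km ->] x kx; apply: CQ; rewrite -(bigcup_grid a l0 m0) -bigcup_seq.
  by exists k.
- move=> S S' /mapP[k _ ->] /mapP[k' _ ->] [x [/interior_subset kx /interior_subset k'x]].
  by rewrite (grid_cube_disjoint l0 m0 kx k'x).
Qed.

End cube_families.

(** * Strictness of the inclusions *)

Section example.
Context {R : realType} {n : nat}.
Implicit Types (Q S : set 'rV[R]_n.+1) (a : 'rV[R]_n.+1) (p l d : R) (h phi : R -> R).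

Lemma integrandB_norm h (r : R) : integrand h -> integrand (fun t => `|h t - r|).
Proof.
move=> [mh h0 ih]; split => //.
  by apply: measurableT_comp => //; exact: measurable_funB.
by apply: loc_integrable_norm; apply: loc_integrableB => //; exact: cst_loc_integrable.
Qed.

Lemma continuous_integrand h : continuous h -> (forall t, 0 <= h t) -> integrand h.
Proof.
move=> ch h0; split => //; first exact: continuous_measurable_fun.
exact: continuous_loc_integrable.
Qed.

Lemma avg_coordinate_oscillation a l lo hi phi : 0 < l -> integrand phi ->
  avg (cube a l lo hi) (fun x => `|phi (x ord0 ord0) -
    avg (cube a l lo hi) (fun y => `|phi (y ord0 ord0)|)|) =
  mean (a ord0 ord0) l (fun t => `|phi t - mean (a ord0 ord0) l phi|).
Proof.
move=> l0 iphi; have [mphi phi0 lphi] := iphi.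
have -> : (fun y : 'rV[R]_n.+1 => `|phi (y ord0 ord0)|) = (fun y => phi (y ord0 ord0)).
  by apply/funext => y; rewrite ger0_norm.
rewrite avg_cube//.
have [m1 m2 m3] := integrandB_norm (mean (a ord0 ord0) l phi) iphi.
exact: (avg_cube a lo hi l0 m1 m2 m3).
Qed.

(** One J is chosen for the whole finite family; the sum is then at most C times |Q| plus the
    integral of v_J over Q, hence at most 3 C |Q|. J depends on the family, the bound does not. *)
Lemma coordinate_JNt p C Q phi (v : nat -> R -> R) : 0 < p -> 0 <= C -> is_cube Q ->
  integrand phi -> (forall k, integrand (v k)) ->
  (forall c l, 0 < l -> exists j, forall J, (j <= J)%N ->
     mean c l (fun t => `|phi t - mean c l phi|) `^ p <= C * (1 + mean c l (v J))) ->
  (forall J, avg Q (fun x => v J (x ord0 ord0)) <= 2) ->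
  (JNt_norm p Q (fun x => phi (x ord0 ord0)) < +oo)%E.
Proof.
move=> p0 C0 cQ iphi iv osc vQ; apply/(cube_norm_ltP _ _ p0).
exists (C * (volume Q + volume Q * 2)) => s us cs; have [Cs _ _] := cs.
have [J HJ] : exists J, forall S, S \in s ->
    volume S * avg S (fun x => `|phi (x ord0 ord0) -
      avg S (fun y => `|phi (y ord0 ord0)|)|) `^ p <=
    C * (volume S * avg S (fun=> 1) + volume S * avg S (fun x => v J (x ord0 ord0))).
  apply: eventually_all => S Ss; have cS := Cs S Ss.
  rewrite avg_cst// mulr1.
  have [a [l [lo [hi [l0 SE]]]]] := (is_cubeP S).1 cS.
  have [j Hj] := osc (a ord0 ord0) l l0; exists j => J jJ.
  rewrite -[X in _ <= C * (X + _)]mulr1 -mulrDr mulrCA ler_wpM2l ?volume_ge0//.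
  rewrite SE avg_coordinate_oscillation//; have [m1 m2 m3] := iv J.
  by rewrite avg_cube//; exact: Hj.
rewrite big_seq; apply: (le_trans (ler_sum _ HJ)); rewrite -big_seq -mulr_sumr.
rewrite ler_wpM2l// big_split/=; apply: lerD.
  rewrite -[leRHS]mulr1 -[X in _ <= _ * X](avg_cst 1 cQ).
  apply: (@sum_disjoint_cubes_le R n Q s (fun=> 1) cQ us cs).
  by apply: continuous_integrand => // t; exact: cvg_cst.
apply: (le_trans (sum_disjoint_cubes_le cQ us cs (iv J))).
by rewrite ler_wpM2l ?volume_ge0.
Qed.

(** Provides room for a half-open grid inside Q, whichever faces Q contains. *)
Lemma middle_half_sub a l lo hi : 0 < l ->
  cube (\row_i (a ord0 i + l / 4)) (l / 2) (fun=> false) (fun=> false) `<=` cube a l lo hi.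
Proof.
move=> l0 x xC i; have := xC i; rewrite !mxE !in_itv/= => /andP[h1 h2].
have a1 : a ord0 i < x ord0 i by lra.
have a2 : x ord0 i < a ord0 i + l by lra.
by apply/andP; split; [case: (lo i)|case: (hi i)] => //=; exact: ltW.
Qed.

(** If [M] bounded the RM sums, a grid of mesh at most [d] on the cube C would give J |C|/2 <= 2^p
    (M + 2^p |C|), through the integral over C of the sum of the v_k with k < J. The right side is
    independent of J. *)
Lemma coordinate_not_RM p Q phi (v : nat -> R -> R) a l : 0 < p -> 0 < l ->
  cube a l (fun=> false) (fun=> false) `<=` Q ->
  integrand phi -> (forall k, integrand (v k)) ->
  (forall k, 2^-1 <= mean (a ord0 ord0) l (v k)) ->
  (forall J, exists2 d, 0 < d & forall c l, 0 < l <= d ->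
     \sum_(k < J) mean c l (v k) <= 2 `^ p * (mean c l phi `^ p + 2 `^ p)) ->
  ~ (RM_norm p Q (fun x => phi (x ord0 ord0)) < +oo)%E.
Proof.
move=> p0 l0 CQ iphi iv vQ lower /(cube_norm_ltP _ _ p0)[M HM].
have [mphi phi0 lphi] := iphi.
pose C : set 'rV[R]_n.+1 := cube a l (fun=> false) (fun=> false).
have cC : is_cube C by apply/is_cubeP; do 4!eexists; split; [exact: l0|reflexivity].
have V0 := volume_gt0 cC.
pose B := 2 `^ p * (M + volume C * 2 `^ p).
have key J : J%:R * (volume C * 2^-1) <= B.
  have [d d0 Hd] := lower J.
  pose m := (Num.bound (l / d)).+1.
  have m0 : (0 < m)%N by [].
  have mR0 : 0 < m%:R :> R by rewrite ltr0n.
  have md : l / m%:R <= d.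
    rewrite ler_pdivrMr// mulrC -ler_pdivrMr//; apply: ltW.
    apply: (lt_trans (archi_boundP _)); first by rewrite divr_ge0// ltW.
    by rewrite ltr_nat.
  have us := grid_uniq a l0 m0.
  have cs := grid_collection l0 m0 CQ.
  have := HM _ us cs; set T := \sum_(S <- _) _ => TM.
  have sumV h : integrand h -> \sum_(S <- grid a l m) volume S * avg S (fun x => h (x ord0 ord0)) =
      volume C * avg C (fun x => h (x ord0 ord0)) by exact: sum_grid.
  have one : \sum_(S <- grid a l m) volume S = volume C.
    have i1 : @integrand R (fun=> 1) by apply: continuous_integrand => // t; exact: cvg_cst.
    have := sumV _ i1; rewrite (avg_cst 1 cC) mulr1 => <-.
    rewrite big_seq [RHS]big_seq; apply: eq_bigr => S Ss.
    by have [Cs _ _] := cs; rewrite (avg_cst 1 (Cs S Ss)) mulr1.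
  apply: (@le_trans _ _ (\sum_(S <- grid a l m) volume S *
     \sum_(k < J) avg S (fun x => v k (x ord0 ord0)))).
    under eq_bigr do rewrite mulr_sumr.
    rewrite exchange_big/=.
    rewrite (_ : J%:R * _ = \sum_(k < J) volume C * 2^-1); last first.
      by rewrite sumr_const card_ord mulr_natl.
    apply: ler_sum => k _; rewrite sumV// ler_wpM2l ?volume_ge0//.
    by have [m1 m2 m3] := iv k; rewrite avg_cube.
  apply: (@le_trans _ _ (\sum_(S <- grid a l m) 2 `^ p *
      (volume S * avg S (fun x => `|phi (x ord0 ord0)|) `^ p + volume S * 2 `^ p))).
    rewrite big_map [leRHS]big_map; apply: ler_sum => k _.
    rewrite -[X in _ <= 2 `^ p * X]mulrDr mulrCA ler_wpM2l ?volume_ge0//.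
    have e0 : 0 < l / m%:R by rewrite divr_gt0.
    have -> : (fun x : 'rV[R]_n.+1 => `|phi (x ord0 ord0)|) = (fun x => phi (x ord0 ord0)).
      by apply/funext => x; rewrite ger0_norm.
    rewrite /grid_cube avg_cube//.
    under eq_bigr => i _.
      have [m1 m2 m3] := iv i.
      rewrite avg_cube//.
      over.
    by apply: Hd; rewrite e0.
  rewrite -mulr_sumr big_split/= -mulr_suml one /B ler_wpM2l ?powR_ge0// lerD2r.
  exact: TM.
have B0 : 0 <= B by have := key 0%N; rewrite mul0r.
have := key (Num.bound (B / (volume C * 2^-1))).
have Vh : 0 < volume C * 2^-1 by rewrite mulr_gt0.
by rewrite leNgt => /negP; apply; rewrite -ltr_pdivrMr// archi_boundP// divr_ge0// ltW.
Qed.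

Lemma exists_JNt_not_RM p Q : 1 < p -> is_cube Q ->
  exists f : 'rV[R]_n.+1 -> R, [/\ forall x, 0 <= f x, JNt p Q f & ~ RM p Q f].
Proof.
move=> p1 cQ; have p0 : 0 < p by exact: lt_trans p1.
have [a [l [lo [hi [l0 QE]]]]] := (is_cubeP Q).1 cQ.
(* Half the edge is the length threshold, so that the means of the v_k are controlled both on Q and
   on its middle half. *)
have l20 : 0 < l / 2 by rewrite divr_gt0.
have [phi [v [C [iphi [C0 cv v0] osc vb lower]]]] := one_dimensional_example p1 l20.
have iv k : integrand (v k) by exact: continuous_integrand.
have [mphi phi0 lphi] := iphi.
exists (fun x => phi (x ord0 ord0)); split; first by move=> x; exact: phi0.
- split; first exact: L1_comp_coordinate.
  apply: (coordinate_JNt p0 C0 cQ iphi iv osc) => J.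
  rewrite QE; have [m1 m2 m3] := iv J; rewrite avg_cube//.
  by have /andP[] := vb (a ord0 ord0) l J (ltac:(lra)).
- move=> [_].
  apply: (@coordinate_not_RM p Q phi v (\row_i (a ord0 i + l / 4)) (l / 2)) => //.
    by rewrite QE; exact: middle_half_sub.
  by move=> k; have /andP[] := vb ((\row_i (a ord0 i + l / 4) : 'rV[R]_n.+1) ord0 ord0) (l / 2) k (lexx _).
Qed.

End example.

Theorem mainTheorem7 (R : realType) (n : nat) (p : R) (Q : set 'rV[R]_n.+1)
    (p_gt1 : 1 < p) (cube_Q : is_cube Q) :
  RM p Q `<` JNt p Q /\ JNt p Q `<` JN p Q.
Proof.
have p0 : 0 < p by exact: lt_trans p_gt1.
have [f [f0 fJ fR]] := exists_JNt_not_RM p_gt1 cube_Q.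
split; split.
- exact: RM_sub_JNt.
- by move=> /(_ _ fJ).
- exact: JNt_sub_JN.
(* The witness is -f: it lies in JN_p, and its membership in JNt_p would put f in RM_p. *)
- move=> /(_ _ (JN_oppr p0 cube_Q (JNt_sub_JN p0 cube_Q fJ))) fN.
  exact: fR (JNt_oppr_RM p0 cube_Q f0 (proj1 fJ) fN).
Qed.
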